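(* Let $a>0$ and let $M$ be the spin bundle of $S^3$ with its Bryant–Salamon $\mathrm{G}_2$-structure with parameter $a$, its $T^3$-action and its multi-moment map $(\nu,\mu)=(\nu_1,\nu_2,\nu_3,\mu)\colon M\to\mathbb R^4$. Then $(\nu,\mu)$ induces a homeomorphism from the orbit space $M/T^3$ onto $\mathbb R^4$. Under it, the image of the singular orbits is a connected trivalent graph with two vertices $(0,0,\pm k,0)$, where $k=2a/(3\sqrt3)$, consisting of the line segment from $(0,0,-k,0)$ to $(0,0,k,0)$ together with the four half-lines $\{(\varepsilon_1t,\varepsilon_2t,\varepsilon_1\varepsilon_2(t+k),0) : t\geqslant0\}$, $\varepsilon_1,\varepsilon_2\in\{\pm1\}$.
   Context: Identify $S^3=\mathrm{Sp}(1)\subset\mathbb H$ with the unit quaternions. On $S^3\times S^3$ take the vector fields $E_1(p,q)=(pi,0)$, $E_2(p,q)=(pj,0)$, $E_3(p,q)=(-pk,0)$, $F_1(p,q)=(0,qi)$, $F_2(p,q)=(0,qj)$, $F_3(p,q)=(0,-qk)$ (here $i,j,k$ are the quaternion units), with dual co-frame $e^1,e^2,e^3,f^1,f^2,f^3$. Put (wedge signs suppressed) $\sigma=\tfrac{2}{3\sqrt3}(e^1f^1+e^2f^2+e^3f^3)$ and $\hat\psi=\tfrac4{27}(-2e^{123}-2f^{123}+e^1f^{23}+e^2f^{31}+e^3f^{12}+e^{23}f^1+e^{31}f^2+e^{12}f^3)$. The Bryant–Salamon structure away from the zero section is, on $\{r: r^3>4a\}\times S^3\times S^3$, $$\varphi=-\tfrac{4}{3\sqrt3}a(e^{123}-f^{123})+d\bigl(\tfrac13(r^3-a)\sigma\bigr),\quad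 *\varphi=\tfrac49a\,dr\wedge(e^{123}+f^{123})+(r^3-a)\hat\psi\wedge dr+\tfrac12r(r^3-4a)\sigma^2 .$$ The full manifold $M$ (the spin bundle, an $\mathbb R^4$-bundle over $S^3$) is obtained by adding the zero section at $r^3=4a$, where the orbits of the right diagonal action $(p,q)\mapsto(p\ell^{-1},q\ell^{-1})$, $\ell\in\mathrm{Sp}(1)$, are collapsed to points; topologically $M$ is the quotient of $[(4a)^{1/3},\infty)\times S^3\times S^3$ by this identification over $r=(4a)^{1/3}$. $\mathrm{Sp}(1)^3$ acts by $((h,m,\ell),(p,q))\mapsto(hp\ell^{-1},mq\ell^{-1})$; take the circle $\{e^{i\theta}\}$ in each factor, and let $T^3$ be the resulting three-torus divided by $\{\pm(1,1,1)\}$, which acts effectively on $M$. The generating vector fields are $U_1=(ip,0)$, $U_2=(0,iq)$, $U_3=(-pi,-qi)$. The multi-moment maps, satisfying $d\nu_1=\varphi(U_2,U_3,\cdot)$, $d\nu_2=\varphi(U_3,U_1,\cdot)$, $d\nu_3=\varphi(U_1,U_2,\cdot)$, $d\mu=*\varphi(U_1,U_2,U_3,\cdot)$, are, with $\langle\cdot,\cdot\rangle$ the standard inner product on $\operatorname{Im}\mathbb H\cong\mathbb R^3$, $$\nu_1=\tfrac2{9\sqrt3}(r^3-4a)\langle\bar qiq,i\rangle,\quad \nu_2=\tfrac2{9\sqrt3}(r^3-4a)\langle\bar pip,i\rangle,\quad \nu_3=\tfrac2{9\sqrt3}(r^3-a)\langle\bar pip,\bar qiq\rangle,$$ $$\mu=\tfrac2{27}r(r^3-4a)\bigl(\langle\bar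 pip,j\rangle\langle\bar qiq,k\rangle-\langle\bar pip,k\rangle\langle\bar qiq,j\rangle\bigr),$$ extended to the zero section by continuity. Singular orbits are those on which $U_1,U_2,U_3$ are linearly dependent. *)

(* Defs.v *)
From HB Require Import structures.
From mathcomp Require Import all_boot all_order all_algebra.
From mathcomp Require Import all_classical all_reals all_analysis.
From mathcomp Require Import ring lra.
Set Implicit Arguments.
Unset Strict Implicit.
Unset Printing Implicit Defensive.
Import Order.TTheory GRing.Theory Num.Theory.
Import numFieldNormedType.Exports.
Local Open Scope classical_set_scope.
Local Open Scope ring_scope.
Local Open Scope quotient_scope.

Section Quaternions.
Context {R : realType}.
Local Notation H := 'rV[R]_4.

Definition quat (a b c d : R) : H := \row_n [:: a; b; c; d]`_n.
Definition qc (x : H) (n : nat) : R := x 0 (inord n).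

Definition mulq (x y : H) : H := quat
  (qc x 0 * qc y 0 - qc x 1 * qc y 1 - qc x 2 * qc y 2 - qc x 3 * qc y 3)
  (qc x 0 * qc y 1 + qc x 1 * qc y 0 + qc x 2 * qc y 3 - qc x 3 * qc y 2)
  (qc x 0 * qc y 2 - qc x 1 * qc y 3 + qc x 2 * qc y 0 + qc x 3 * qc y 1)
  (qc x 0 * qc y 3 + qc x 1 * qc y 2 - qc x 2 * qc y 1 + qc x 3 * qc y 0).
Definition conjq (x : H) : H := quat (qc x 0) (- qc x 1) (- qc x 2) (- qc x 3).
Definition normq2 (x : H) : R :=
  qc x 0 ^+ 2 + qc x 1 ^+ 2 + qc x 2 ^+ 2 + qc x 3 ^+ 2.

Definition qi : H := quat 0 1 0 0.
Definition qj : H := quat 0 0 1 0.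
Definition qk : H := quat 0 0 0 1.

(* The inner product of Im H; real parts are ignored. *)
Definition dotIm (x y : H) : R :=
  qc x 1 * qc y 1 + qc x 2 * qc y 2 + qc x 3 * qc y 3.

Lemma qcE a b c d : (qc (quat a b c d) 0 = a) * (qc (quat a b c d) 1 = b) *
  (qc (quat a b c d) 2 = c) * (qc (quat a b c d) 3 = d).
Proof. by rewrite /qc /quat !mxE !inordK. Qed.

Lemma quat_ext x y : qc x 0 = qc y 0 -> qc x 1 = qc y 1 -> qc x 2 = qc y 2 ->
  qc x 3 = qc y 3 -> x = y.
Proof.
rewrite /qc => h0 h1 h2 h3; apply/rowP => n; rewrite -[n]inord_val.
by case: n => [[|[|[|[|n]]]] ?].
Qed.

Lemma qcD x y n : qc (x + y) n = qc x n + qc y n.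
Proof. by rewrite /qc mxE. Qed.
Lemma qcN x n : qc (- x) n = - qc x n.
Proof. by rewrite /qc mxE. Qed.
Lemma qcZ (t : R) x n : qc (t *: x) n = t * qc x n.
Proof. by rewrite /qc mxE. Qed.
Lemma qc0 n : qc 0 n = 0.
Proof. by rewrite /qc mxE. Qed.

Lemma mulqA : associative mulq.
Proof. by move=> x y z; apply: quat_ext; rewrite !qcE; ring. Qed.

Lemma conjqM x y : conjq (mulq x y) = mulq (conjq y) (conjq x).
Proof. by apply: quat_ext; rewrite !qcE; ring. Qed.

Lemma conjqK : involutive conjq.
Proof. by move=> x; apply: quat_ext; rewrite !qcE; ring. Qed.

Lemma normq2M x y : normq2 (mulq x y) = normq2 x * normq2 y.
Proof. by rewrite /normq2 !qcE; ring. Qed.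

Lemma normq2J x : normq2 (conjq x) = normq2 x.
Proof. by rewrite /normq2 !qcE; ring. Qed.

Lemma mulqJ x : mulq x (conjq x) = quat (normq2 x) 0 0 0.
Proof. by apply: quat_ext; rewrite !qcE /normq2; ring. Qed.

Lemma mulJq x : mulq (conjq x) x = quat (normq2 x) 0 0 0.
Proof. by apply: quat_ext; rewrite !qcE /normq2; ring. Qed.

Lemma mulq1 x : mulq x (quat 1 0 0 0) = x.
Proof. by apply: quat_ext; rewrite !qcE; ring. Qed.

Lemma mul1q x : mulq (quat 1 0 0 0) x = x.
Proof. by apply: quat_ext; rewrite !qcE; ring. Qed.

Lemma mulqN x y : mulq x (- y) = - mulq x y.
Proof. by apply: quat_ext; rewrite !(qcE, qcN); ring. Qed.

Lemma mulNq x y : mulq (- x) y = - mulq x y.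
Proof. by apply: quat_ext; rewrite !(qcE, qcN); ring. Qed.

Lemma conjqN x : conjq (- x) = - conjq x.
Proof. by apply: quat_ext; rewrite !(qcE, qcN). Qed.

Definition sphere3 : set H := [set x | normq2 x = 1].
Local Notation S3 := (set_type sphere3).

Lemma S3P (x : S3) : normq2 (val x) = 1.
Proof. by case: x => x /= /set_mem. Qed.

Lemma S3_mul_subproof (x y : S3) : mulq (val x) (val y) \in sphere3.
Proof. by apply/mem_set; rewrite /sphere3 /= normq2M !S3P mulr1. Qed.
Definition mulS3 (x y : S3) : S3 := exist _ (mulq (val x) (val y)) (S3_mul_subproof x y).

Lemma S3_conj_subproof (x : S3) : conjq (val x) \in sphere3.
Proof. by apply/mem_set; rewrite /sphere3 /= normq2J S3P. Qed.
Definition invS3 (x : S3) : S3 := exist _ (conjq (val x)) (S3_conj_subproof x).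

Lemma S3_one_subproof : quat 1 0 0 0 \in sphere3.
Proof. by apply/mem_set; rewrite /sphere3 /= /normq2 !qcE; ring. Qed.
Definition oneS3 : S3 := exist _ (quat 1 0 0 0) S3_one_subproof.

Lemma mulS3A : associative mulS3.
Proof. by move=> x y z; apply/val_inj; rewrite /= mulqA. Qed.
Lemma mulS31 : right_id oneS3 mulS3.
Proof. by move=> x; apply/val_inj; rewrite /= mulq1. Qed.
Lemma mul1S3 : left_id oneS3 mulS3.
Proof. by move=> x; apply/val_inj; rewrite /= mul1q. Qed.
Lemma mulS3V : right_inverse oneS3 invS3 mulS3.
Proof. by move=> x; apply/val_inj; rewrite /= mulqJ S3P. Qed.
Lemma mulVS3 : left_inverse oneS3 invS3 mulS3.
Proof. by move=> x; apply/val_inj; rewrite /= mulJq S3P. Qed.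
Lemma invS3M x y : invS3 (mulS3 x y) = mulS3 (invS3 y) (invS3 x).
Proof. by apply/val_inj; rewrite /= conjqM. Qed.
Lemma invS3K : involutive invS3.
Proof. by move=> x; apply/val_inj; rewrite /= conjqK. Qed.
Lemma invS31 : invS3 oneS3 = oneS3.
Proof. by rewrite -[LHS]mul1S3 mulS3V. Qed.

Lemma expi_subproof (t : R) : quat (cos t) (sin t) 0 0 \in sphere3.
Proof. by apply/mem_set; rewrite /sphere3 /= /normq2 !qcE -(cos2Dsin2 t); ring. Qed.
Definition expi (t : R) : S3 := exist _ (quat (cos t) (sin t) 0 0) (expi_subproof t).

End Quaternions.
Arguments sphere3 : clear implicits.
Notation S3 R := (set_type (sphere3 R)).

(* The radial half-line [(4a)^(1/3), +oo[ (for 0 < a). *)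
Definition radii {R : realType} (a : R) : set R := [set r | 4 * a <= r ^+ 3].
Notation base R a := (set_type (@radii R a) * S3 R * S3 R)%type.

Section SpinBundle.
Context {R : realType} {a : R}.
Local Notation H := 'rV[R]_4.

Definition base_val (z : base R a) : R * H * H := (val z.1.1, val z.1.2, val z.2).

Definition off_zero (z : base R a) : Prop := 4 * a < val z.1.1 ^+ 3.

Definition collapse : rel (base R a) := fun z w =>
  `[< z = w \/
      [/\ val z.1.1 ^+ 3 = 4 * a, w.1.1 = z.1.1 &
          exists l : S3 R, w.1.2 = mulS3 z.1.2 (invS3 l) /\
                           w.2 = mulS3 z.2 (invS3 l)] >].

Lemma collapse_refl : reflexive collapse.
Proof. by move=> z; apply/asboolP; left. Qed.

Lemma collapse_sym : symmetric collapse.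
Proof.
suff h z w : collapse z w -> collapse w z by move=> z w; apply/idP/idP; apply: h.
move=> /asboolP[->|[z0 wz [l [w1 w2]]]]; first exact: collapse_refl.
apply/asboolP; right; split => //; first by rewrite wz.
exists (invS3 l); rewrite w1 w2.
by split; rewrite -mulS3A mulS3V mulS31.
Qed.

Lemma collapse_trans : transitive collapse.
Proof.
move=> y x z /asboolP[->//|[x0 yx [l [y1 y2]]]].
move=> /asboolP[<-|[y0 zy [m [z1 z2]]]]; apply/asboolP; right; split => //.
- by exists l.
- by rewrite zy yx.
- by exists (mulS3 m l); rewrite z1 z2 y1 y2 invS3M !mulS3A.
Qed.

End SpinBundle.

Canonical collapse_equiv {R : realType} (a : R) := EquivRel (@collapse R a)
  (@collapse_refl R a) (@collapse_sym R a) (@collapse_trans R a).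

Notation spin_bundle a := (quotient_topology {eq_quot (collapse_equiv a)}).

Definition circle (R : realType) : set (S3 R) := range expi.
Arguments circle : clear implicits.
Notation circle3 R :=
  (set_type (circle R) * set_type (circle R) * set_type (circle R))%type.

Section Torus.
Context {R : realType}.
Local Notation H := 'rV[R]_4.
Implicit Types (s t : circle3 R) (x y : R).

Definition same_up_to_sign : rel (circle3 R) := fun s t =>
  `[< s = t \/
      [/\ val (val t.1.1) = - val (val s.1.1) :> H,
          val (val t.1.2) = - val (val s.1.2) :> H &
          val (val t.2) = - val (val s.2) :> H] >].

Lemma same_up_to_sign_refl : reflexive same_up_to_sign.
Proof. by move=> s; apply/asboolP; left. Qed.

Lemma same_up_to_sign_sym : symmetric same_up_to_sign.
Proof.
suff h s t : same_up_to_sign s t -> same_up_to_sign t s.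
  by move=> s t; apply/idP/idP; apply: h.
move=> /asboolP[->|[t1 t2 t3]]; first exact: same_up_to_sign_refl.
by apply/asboolP; right; rewrite t1 t2 t3 !opprK.
Qed.

Lemma same_up_to_sign_trans : transitive same_up_to_sign.
Proof.
move=> [[t1 t2] t3] [[s1 s2] s3] [[u1 u2] u3] /asboolP[[-> -> ->]//|/= [ts1 ts2 ts3]].
move=> /asboolP[[<- <- <-]|/= [ut1 ut2 ut3]]; apply/asboolP; first by right.
by left; congr (_, _, _); do 2 apply/val_inj; rewrite /= ?ut1 ?ut2 ?ut3 ?ts1 ?ts2 ?ts3 opprK.
Qed.

Canonical same_up_to_sign_equiv := EquivRel same_up_to_sign
  same_up_to_sign_refl same_up_to_sign_sym same_up_to_sign_trans.

Lemma expiD x y : expi (x + y) = mulS3 (expi x) (expi y).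
Proof.
by apply/val_inj/quat_ext; rewrite /= !qcE ?cosD ?sinD; ring.
Qed.

Lemma expi0 : expi 0 = oneS3 :> S3 R.
Proof. by apply/val_inj/quat_ext; rewrite /= !qcE ?cos0 ?sin0. Qed.

Lemma expiN x : expi (- x) = invS3 (expi x).
Proof. by apply/val_inj/quat_ext; rewrite /= !qcE ?cosN ?sinN ?oppr0. Qed.

Lemma circle_exp_subproof x : expi x \in circle R.
Proof. by apply/mem_set; exists x. Qed.
Definition circle_exp x : set_type (circle R) :=
  exist _ (expi x) (circle_exp_subproof x).

Lemma circle_expP (u : set_type (circle R)) : exists x, u = circle_exp x.
Proof. by case: u => u uP; have [x _ ux] := set_mem uP; exists x; apply/val_inj. Qed.

End Torus.

Notation torus3 R := {eq_quot (@same_up_to_sign_equiv R)}.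

Section Action.
Context {R : realType} {a : R}.
Implicit Types (z w : base R a) (s : circle3 R).
Local Notation H := 'rV[R]_4.

Definition sp1_act (h m l : S3 R) z : base R a :=
  (z.1.1, mulS3 (mulS3 h z.1.2) (invS3 l), mulS3 (mulS3 m z.2) (invS3 l)).

Lemma sp1_act1 z : sp1_act oneS3 oneS3 oneS3 z = z.
Proof. by rewrite /sp1_act invS31 !mulS31 !mul1S3; case: z => [[]]. Qed.

Lemma sp1_actM h m l h' m' l' z :
  sp1_act h m l (sp1_act h' m' l' z) =
  sp1_act (mulS3 h h') (mulS3 m m') (mulS3 l l') z.
Proof. by rewrite /sp1_act /= invS3M !mulS3A. Qed.

Lemma sp1_act_collapse h m l z w : collapse z w ->
  collapse (sp1_act h m l z) (sp1_act h m l w).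
Proof.
move=> /asboolP[->|[z0 wz [n [w1 w2]]]]; first exact: collapse_refl.
apply/asboolP; right; split => //.
exists (mulS3 (mulS3 l n) (invS3 l)); rewrite /sp1_act /= w1 w2.
have e (u v : S3 R) : mulS3 (mulS3 u (mulS3 v (invS3 n))) (invS3 l) =
    mulS3 (mulS3 (mulS3 u v) (invS3 l)) (invS3 (mulS3 (mulS3 l n) (invS3 l))).
  rewrite !invS3M invS3K !mulS3A; congr (mulS3 _ _).
  by rewrite -(mulS3A _ (invS3 l) l) mulVS3 mulS31.
by split; exact: e.
Qed.

Definition circle3_act s z := sp1_act (val s.1.1) (val s.1.2) (val s.2) z.

Lemma circle3_act_sign s s' z :
  same_up_to_sign s s' -> circle3_act s z = circle3_act s' z.
Proof.
move=> /asboolP[->//|[s1 s2 s3]].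
have e (h h' l l' p : S3 R) : val h' = - val h :> H -> val l' = - val l :> H ->
    mulS3 (mulS3 h p) (invS3 l) = mulS3 (mulS3 h' p) (invS3 l').
  move=> h'E l'E; apply/val_inj; rewrite /= in h'E l'E *.
  by rewrite h'E l'E conjqN !mulNq mulqN opprK.
by congr (_, _, _); exact: e.
Qed.

Definition torus_act (t : torus3 R) (x : spin_bundle a) : spin_bundle a :=
  \pi_(spin_bundle a) (circle3_act (repr t) (repr x)).

Lemma pi_spinP z w :
  (\pi_(spin_bundle a) z = \pi_(spin_bundle a) w) <-> collapse z w.
Proof.
split=> [e|zw]; last by apply/(@eqquotP _ _ {eq_quot (collapse_equiv a)}).
exact/(@eqquotP _ _ {eq_quot (collapse_equiv a)}).
Qed.

Lemma repr_spin z : collapse z (repr (\pi_(spin_bundle a) z)).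
Proof. by apply/pi_spinP; rewrite reprK. Qed.

Lemma torus_actE s z :
  torus_act (\pi_(torus3 R) s) (\pi_(spin_bundle a) z) =
  \pi_(spin_bundle a) (circle3_act s z).
Proof.
have sr : same_up_to_sign s (repr (\pi_(torus3 R) s)).
  by apply/(@eqquotP _ _ (torus3 R)); rewrite reprK.
rewrite /torus_act -(circle3_act_sign _ sr).
by apply/esym/pi_spinP/sp1_act_collapse/repr_spin.
Qed.

Definition same_orbit : rel (spin_bundle a) := fun x y =>
  `[< exists t : torus3 R, y = torus_act t x >].

Lemma same_orbitP z w : same_orbit (\pi_(spin_bundle a) z) (\pi_(spin_bundle a) w) <->
  exists x y u, \pi_(spin_bundle a) w =
    \pi_(spin_bundle a) (sp1_act (expi x) (expi y) (expi u) z).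
Proof.
split=> [/asboolP[t]|[x [y [u e]]]].
  rewrite -[t]reprK torus_actE; case: (repr t) => [[t1 t2] t3].
  have [x ->] := circle_expP t1; have [y ->] := circle_expP t2.
  by have [u ->] := circle_expP t3; exists x, y, u.
apply/asboolP; exists (\pi_(torus3 R) ((circle_exp x, circle_exp y), circle_exp u)).
by rewrite torus_actE.
Qed.

Lemma same_orbit_refl : reflexive same_orbit.
Proof.
move=> x; rewrite -[x]reprK; apply/same_orbitP; exists 0, 0, 0.
by rewrite !expi0 sp1_act1.
Qed.

Lemma same_orbit_sym : symmetric same_orbit.
Proof.
suff h x y : same_orbit x y -> same_orbit y x.
  by move=> x y; apply/idP/idP; apply: h.
rewrite -[x]reprK -[y]reprK => /same_orbitP[u [v [w e]]].
apply/same_orbitP; exists (- u), (- v), (- w).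
move/pi_spinP: e => /(sp1_act_collapse (expi (- u)) (expi (- v)) (expi (- w))).
by rewrite sp1_actM -!expiD !addNr !expi0 sp1_act1 => /pi_spinP.
Qed.

Lemma same_orbit_trans : transitive same_orbit.
Proof.
move=> y x z; rewrite -[x]reprK -[y]reprK -[z]reprK.
move=> /same_orbitP[u [v [w e]]] /same_orbitP[u' [v' [w' ->]]].
apply/same_orbitP; exists (u' + u), (v' + v), (w' + w).
rewrite !expiD -sp1_actM; apply/pi_spinP/sp1_act_collapse; exact/pi_spinP.
Qed.

End Action.

Canonical same_orbit_equiv {R : realType} (a : R) := EquivRel (@same_orbit R a)
  (@same_orbit_refl R a) (@same_orbit_sym R a) (@same_orbit_trans R a).

Notation orbit_space a := (quotient_topology {eq_quot (same_orbit_equiv a)}).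

(* Infinitesimal action.  M is trivialised as S^3 x H: the right diagonal orbit *)
(* of (p, q) is p q^-1, and r^3 - 4a is a smooth function vanishing to second   *)
(* order along the zero section, so that (r, p, q) is sent to                   *)
(* (p q^-1, sqrt (r^3 - 4a) q).  This is the diffeomorphism defining the smooth *)
(* structure of M across the zero section; tangent vectors of M are read in it, *)
(* as vectors of H x H.                                                         *)
Section Generators.
Context {R : realType} {a : R}.
Implicit Types (z w : base R a).
Local Notation H := 'rV[R]_4.

Definition base_triv z : H * H :=
  (mulq (val z.1.2) (conjq (val z.2)),
   Num.sqrt (val z.1.1 ^+ 3 - 4 * a) *: val z.2).

Definition spin_triv (x : spin_bundle a) : H * H := base_triv (repr x).

Lemma base_triv_collapse z w : collapse z w -> base_triv z = base_triv w.
Proof.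
move=> /asboolP[->//|[z0 wz [l [w1 w2]]]].
rewrite /base_triv w1 w2 wz z0 subrr sqrtr0 !scale0r /= conjqM conjqK.
congr (_, _); rewrite mulqA -(mulqA _ (conjq _)) mulJq S3P mulq1.
by [].
Qed.

Lemma spin_trivE z : spin_triv (\pi_(spin_bundle a) z) = base_triv z.
Proof. by apply/esym/base_triv_collapse/repr_spin. Qed.

(* The one-parameter subgroup of T^3 in the j-th circle. *)
Definition torus_exp (j : 'I_3) (t : R) : torus3 R :=
  let u n := circle_exp (if j == n :> nat then t else 0) in
  \pi_(torus3 R) ((u 0, u 1), u 2).

Definition generator (j : 'I_3) (x : spin_bundle a) : H * H :=
  'D_1 (fun t : R => spin_triv (torus_act (torus_exp j t) x)) 0.

Definition singular_point (x : spin_bundle a) : Prop :=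
  exists c : 'rV[R]_3, c != 0 /\ \sum_j c 0 j *: generator j x = 0.

Definition singular_orbits : set (orbit_space a) :=
  [set o | forall x, \pi_(orbit_space a) x = o -> singular_point x].

(* The generating vector fields U_1, U_2, U_3 on R x S^3 x S^3. *)
Definition U_field (j : nat) z : R * H * H :=
  let p := val z.1.2 in let q := val z.2 in
  nth 0 [:: (0, mulq qi p, 0); (0, 0, mulq qi q); (0, - mulq p qi, - mulq q qi)] j.

End Generators.

(* Left-invariant forms.  A tangent vector at (r, p, q) is left-trivialised as  *)
(* (rho, x, y), standing for (rho, p x, q y), with x, y in Im H.                *)
Section Forms.
Context {R : realType}.
Local Notation H := 'rV[R]_4.
Local Notation TV := (R * H * H)%type.
Implicit Types (u v w x : TV).

(* dr, e^1, e^2, e^3, f^1, f^2, f^3 have indices 0, ..., 6. *)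
Definition coframe (n : nat) v : R :=
  [:: v.1.1; qc v.1.2 1; qc v.1.2 2; - qc v.1.2 3;
             qc v.2 1; qc v.2 2; - qc v.2 3]`_n.

(* The wedge product of the coframe elements with indices s, evaluated on vs. *)
Definition cowedge (s : seq nat) (vs : seq TV) : R :=
  \det (\matrix_(m < size s, n < size s) coframe (nth 0%N s m) (nth 0 vs n)).

Definition wedge22 (w1 w2 : TV -> TV -> R) u v w x : R :=
  w1 u v * w2 w x - w1 u w * w2 v x + w1 u x * w2 v w
  + w1 v w * w2 u x - w1 v x * w2 u w + w1 w x * w2 u v.
Definition wedge31 (w3 : TV -> TV -> TV -> R) (w1 : TV -> R) u v w x : R :=
  w3 u v w * w1 x - w3 u v x * w1 w + w3 u w x * w1 v - w3 v w x * w1 u.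

(* Exterior derivative of a left-invariant 2-form with coefficients depending   *)
(* on r, by Koszul's formula on left-invariant vector fields.                   *)
Definition bracket u v : TV :=
  (0, mulq u.1.2 v.1.2 - mulq v.1.2 u.1.2, mulq u.2 v.2 - mulq v.2 u.2).
Definition ext_d (om : R -> TV -> TV -> R) (r : R) u v w : R :=
  u.1.1 * 'D_1 (fun s => om s v w) r - v.1.1 * 'D_1 (fun s => om s u w) r
  + w.1.1 * 'D_1 (fun s => om s u v) r
  - om r (bracket u v) w + om r (bracket u w) v - om r (bracket v w) u.

Definition sigma u v : R := 2 / (3 * Num.sqrt 3) *
  (cowedge [:: 1; 4]%N [:: u; v] + cowedge [:: 2; 5]%N [:: u; v]
   + cowedge [:: 3; 6]%N [:: u; v]).

Definition psi_hat u v w : R := let m s := cowedge s [:: u; v; w] in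
  4 / 27 * (- 2 * m [:: 1; 2; 3]%N - 2 * m [:: 4; 5; 6]%N
    + m [:: 1; 5; 6]%N + m [:: 2; 6; 4]%N + m [:: 3; 4; 5]%N
    + m [:: 2; 3; 4]%N + m [:: 3; 1; 5]%N + m [:: 1; 2; 6]%N).

Definition phi (a r : R) u v w : R :=
  - (4 / (3 * Num.sqrt 3)) * a *
    (cowedge [:: 1; 2; 3]%N [:: u; v; w] - cowedge [:: 4; 5; 6]%N [:: u; v; w])
  + ext_d (fun s u v => 3^-1 * (s ^+ 3 - a) * sigma u v) r u v w.

Definition star_phi (a r : R) u v w x : R :=
  4 / 9 * a * (cowedge [:: 0; 1; 2; 3]%N [:: u; v; w; x]
               + cowedge [:: 0; 4; 5; 6]%N [:: u; v; w; x])
  + (r ^+ 3 - a) * wedge31 psi_hat (coframe 0) u v w x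
  + 2^-1 * r * (r ^+ 3 - 4 * a) * wedge22 sigma sigma u v w x.

Definition left_triv {a} (z : base R a) v : TV :=
  (v.1.1, mulq (conjq (val z.1.2)) v.1.2, mulq (conjq (val z.2)) v.2).

(* phi(U2,U3,.), phi(U3,U1,.), phi(U1,U2,.), *phi(U1,U2,U3,.) at z. *)
Definition contraction {a} (z : base R a) (n : 'I_4) v : R :=
  let r := val z.1.1 in
  let U j := left_triv z (U_field j z) in
  let w := left_triv z v in
  [:: phi a r (U 1) (U 2) w; phi a r (U 2) (U 0) w; phi a r (U 0) (U 1) w;
      star_phi a r (U 0) (U 1) (U 2) w]`_n.

End Forms.

(* A multi-moment map: a continuous map whose differential off the zero section *)
(* is the given contraction, the differential being evaluated on the velocities *)
(* of curves.                                                                   *)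
Record multi_moment {R : realType} (a : R) := MultiMoment {
  mm_fun :> spin_bundle a -> 'rV[R]_4;
  mm_continuous : continuous mm_fun;
  mm_diff : forall (c : R -> base R a) (v : R * 'rV[R]_4 * 'rV[R]_4),
    off_zero (c 0) -> is_derive (0 : R) 1 (fun t => base_val (c t)) v ->
    forall n, is_derive (0 : R) 1
      (fun t => mm_fun (\pi_(spin_bundle a) (c t)) 0 n) (contraction (c 0) n v) }.

Section NuMu.
Context {R : realType} {a : R}.
Local Notation H := 'rV[R]_4.

Definition point4 (x y u v : R) : 'rV[R]_4 := \row_n [:: x; y; u; v]`_n.

Definition base_numu (z : base R a) : 'rV[R]_4 :=
  let r := val z.1.1 in
  let pip := mulq (conjq (val z.1.2)) (mulq qi (val z.1.2)) in
  let qiq := mulq (conjq (val z.2)) (mulq qi (val z.2)) in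
  point4 (2 / (9 * Num.sqrt 3) * (r ^+ 3 - 4 * a) * dotIm qiq qi)
         (2 / (9 * Num.sqrt 3) * (r ^+ 3 - 4 * a) * dotIm pip qi)
         (2 / (9 * Num.sqrt 3) * (r ^+ 3 - a) * dotIm pip qiq)
         (2 / 27 * r * (r ^+ 3 - 4 * a) *
            (dotIm pip qj * dotIm qiq qk - dotIm pip qk * dotIm qiq qj)).
End NuMu.

Section Calculus.
Context {R : realType}.
Local Notation H := 'rV[R]_4.

Lemma is_derive_lin (V W : normedModType R) (L : V -> W) (f : R -> V) (x : R) df :
  (forall k u v, L (k *: (u - v)) = k *: (L u - L v)) -> continuous L ->
  is_derive x 1 f df -> is_derive x 1 (fun t => L (f t)) (L df).
Proof.
move=> Llin Lcts [dvb dfE].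
have fcvg : (fun h : R => h^-1 *: (f (h *: 1 + x) - f x)) @ 0^' --> df.
  by rewrite -dfE; exact: dvb.
have Lcvg : (fun h : R => h^-1 *: (L (f (h *: 1 + x)) - L (f x))) @ 0^' --> L df.
  rewrite (_ : (fun h => _) =
    L \o (fun h : R => h^-1 *: (f (h *: 1 + x) - f x))); last first.
    by apply/funext => h; rewrite /= Llin.
  by apply: continuous_cvg => //; exact: Lcts.
by apply: DeriveDef; [exact: cvgP Lcvg|exact: cvg_lim Lcvg].
Qed.

Lemma qc_continuous n : continuous (fun x : H => qc x n).
Proof. exact: coord_continuous. Qed.

Lemma is_derive_qc (f : R -> H) (x : R) df n :
  is_derive x 1 f df -> is_derive x 1 (fun t => qc (f t) n) (qc df n).
Proof.
apply: (is_derive_lin (L := fun x : H => qc x n)); last exact: qc_continuous.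
by move=> k u v; rewrite qcZ qcD qcN.
Qed.

Lemma is_derive_fst (V W : normedModType R) (f : R -> V * W) (x : R) df :
  is_derive x 1 f df -> is_derive x 1 (fun t => (f t).1) df.1.
Proof. by apply: (is_derive_lin (L := fst)) => // p; exact: cvg_fst. Qed.

Lemma is_derive_snd (V W : normedModType R) (f : R -> V * W) (x : R) df :
  is_derive x 1 f df -> is_derive x 1 (fun t => (f t).2) df.2.
Proof. by apply: (is_derive_lin (L := snd)) => // p; exact: cvg_snd. Qed.

Lemma is_derive_scalel (V : normedModType R) (f : R -> R) (x : R) df (A : V) :
  is_derive x 1 f df -> is_derive x 1 (fun t => f t *: A) (df *: A).
Proof.
apply: (is_derive_lin (L := fun k : R => k *: A)); last exact: scalel_continuous.
by move=> k u v; rewrite /= -scalerBl scalerA.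
Qed.

Lemma coord_cts (T : topologicalType) (f : T -> H) :
  (forall n, (n < 4)%N -> continuous (fun x => qc (f x) n)) -> continuous f.
Proof.
move=> fn x; apply/cvgrPdist_le => e e0.
have near_n n : (n < 4)%N -> \forall y \near x, `|qc (f x) n - qc (f y) n| <= e.
  by move=> n4; move/cvgrPdist_le: (fn n n4 x) => /(_ e e0).
near=> y.
rewrite /Num.Def.normr/= mx_normrE (bigmax_le _ (ltW e0))//= => -[i j] _ /=.
rewrite !mxE ord1 -[j]inord_val.
have := ltn_ord j; case: (val j) => [|[|[|[|//]]]] _.
- by near: y; exact: (near_n 0).
- by near: y; exact: (near_n 1).
- by near: y; exact: (near_n 2).
- by near: y; exact: (near_n 3).
Unshelve. all: by end_near. Qed.

End Calculus.

Section QuaternionCalculus.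
Context {R : realType}.
Local Notation H := 'rV[R]_4.

Lemma is_derive_coord (f : R -> H) (x : R) df :
  (forall n, (n < 4)%N -> is_derive x 1 (fun t => qc (f t) n) (qc df n)) ->
  is_derive x 1 f df.
Proof.
move=> h.
have hh (i : 'I_1) (j : 'I_4) : is_derive x 1 (fun t => f t i j) (df i j).
  by rewrite ord1 -[j]inord_val; exact/h/ltn_ord.
have fd : derivable f x 1 by apply/derivable_mxP => i j; exact: ex_derive.
apply: DeriveDef => //; rewrite derive_mx //; apply/matrixP => i j.
by rewrite mxE; exact: derive_val.
Qed.

Lemma forall4 (P : nat -> Prop) : P 0 -> P 1 -> P 2 -> P 3 -> forall n, (n < 4)%N -> P n.
Proof. by move=> ? ? ? ? [|[|[|[|]]]]. Qed.

Lemma is_derive_mulq (f g : R -> H) (x : R) df dg :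
  is_derive x 1 f df -> is_derive x 1 g dg ->
  is_derive x 1 (fun t => mulq (f t) (g t)) (mulq df (g x) + mulq (f x) dg).
Proof.
move=> hf hg; apply: is_derive_coord.
have f' n := is_derive_qc n hf; have g' n := is_derive_qc n hg.
apply: forall4; rewrite qcD; (under eq_fun do rewrite !qcE); rewrite !qcE.
- apply: is_derive_eq; rewrite /GRing.scale /=; ring.
- apply: is_derive_eq; rewrite /GRing.scale /=; ring.
- apply: is_derive_eq; rewrite /GRing.scale /=; ring.
- apply: is_derive_eq; rewrite /GRing.scale /=; ring.
Qed.

Lemma is_derive_conjq (f : R -> H) (x : R) df :
  is_derive x 1 f df -> is_derive x 1 (fun t => conjq (f t)) (conjq df).
Proof.
move=> hf; apply: is_derive_coord; have f' n := is_derive_qc n hf.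
apply: forall4; (under eq_fun do rewrite !qcE); rewrite !qcE //; exact: is_deriveN.
Qed.

Lemma is_derive_dotIm (f g : R -> H) (x : R) df dg :
  is_derive x 1 f df -> is_derive x 1 g dg ->
  is_derive x 1 (fun t => dotIm (f t) (g t)) (dotIm df (g x) + dotIm (f x) dg).
Proof.
move=> hf hg; have f' n := is_derive_qc n hf; have g' n := is_derive_qc n hg.
rewrite /dotIm; apply: is_derive_eq; rewrite /GRing.scale /=; ring.
Qed.

Lemma is_derive_unit (f : R -> H) (x : R) df : (forall t, normq2 (f t) = 1) ->
  is_derive x 1 f df -> conjq (mulq (conjq (f x)) df) = - mulq (conjq (f x)) df.
Proof.
move=> f1 hf.
have : is_derive x 1 (fun t => mulq (conjq (f t)) (f t)) 0.
  under eq_fun do rewrite mulJq f1; exact: is_derive_cst.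
move=> [_]; have [_ ->] := is_derive_mulq (is_derive_conjq hf) hf.
rewrite conjqM conjqK => e; apply/eqP.
by rewrite -addr_eq0 e.
Qed.

End QuaternionCalculus.

Section Hopf.
Context {R : realType}.
Local Notation H := 'rV[R]_4.

Definition hopf (p : H) : H := mulq (conjq p) (mulq qi p).

Lemma normq2_dotIm (x y : H) :
  dotIm x y = 2^-1 * (normq2 (x + y) - normq2 x - normq2 y) - qc x 0 * qc y 0.
Proof. by rewrite /normq2 /dotIm !qcD; field. Qed.

Lemma mulqDr (x y z : H) : mulq x (y + z) = mulq x y + mulq x z.
Proof. by apply: quat_ext; rewrite !(qcE, qcD); ring. Qed.
Lemma mulqDl (x y z : H) : mulq (x + y) z = mulq x z + mulq y z.
Proof. by apply: quat_ext; rewrite !(qcE, qcD); ring. Qed.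

Lemma hopf_re (p : H) : qc (hopf p) 0 = 0.
Proof. by rewrite !qcE; ring. Qed.

Lemma dotIm_hopf (p q l : H) : normq2 l = 1 ->
  dotIm (hopf (mulq p l)) (hopf (mulq q l)) = dotIm (hopf p) (hopf q).
Proof.
have hE (u v : H) : hopf (mulq u v) = mulq (mulq (conjq v) (hopf u)) v.
  by rewrite /hopf conjqM !mulqA.
move=> l1; rewrite 2!normq2_dotIm !hopf_re; congr (_ * _ - _).
by rewrite !hE -mulqDl -mulqDr !normq2M normq2J l1 !(mul1r, mulr1).
Qed.

Lemma is_derive_hopf (f : R -> H) (x : R) df : (forall t, normq2 (f t) = 1) ->
  is_derive x 1 f df ->
  let y := mulq (conjq (f x)) df in
  is_derive x 1 (fun t => hopf (f t)) (mulq (hopf (f x)) y - mulq y (hopf (f x))).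
Proof.
move=> f1 hf y; have yN := is_derive_unit f1 hf.
have i' : is_derive x 1 (fun t => mulq qi (f t)) (mulq qi df).
  apply: is_derive_eq; first exact: is_derive_mulq (is_derive_cst qi x 1) hf.
  by apply: quat_ext; rewrite !(qcE, qcD, qc0); ring.
apply: is_derive_eq; first exact: is_derive_mulq (is_derive_conjq hf) i'.
rewrite addrC; congr (_ + _).
  by rewrite /y /hopf -!mulqA [mulq (f x) _]mulqA mulqJ f1 mul1q.
rewrite -mulNq -yN conjqM conjqK /hopf -!mulqA [mulq (f x) _]mulqA.
by rewrite mulqJ f1 mul1q.
Qed.

Lemma cowedge2 i j (u v : R * H * H) : cowedge [:: i; j] [:: u; v] =
  coframe i u * coframe j v - coframe i v * coframe j u.
Proof.
rewrite /cowedge (expand_det_row _ ord0) !big_ord_recl big_ord0 /cofactor.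
by rewrite !det_mx11 !mxE /= addr0 expr0 expr1 !(mul1r, mulN1r, mulrN).
Qed.

Lemma cowedge3 i j k (u v w : R * H * H) : cowedge [:: i; j; k] [:: u; v; w] =
  coframe i u * cowedge [:: j; k] [:: v; w] - coframe i v * cowedge [:: j; k] [:: u; w]
  + coframe i w * cowedge [:: j; k] [:: u; v].
Proof.
rewrite {1}/cowedge (expand_det_row _ ord0) !big_ord_recl big_ord0 /cofactor /=.
rewrite !mxE /= addr0 /bump /= !addn0 expr0 expr1 sqrrN expr1n.
rewrite !mul1r mulN1r mulrN addrA; congr (_ * _ - _ * _ + _ * _).
- by congr (\det _); apply/matrixP => -[[|[|m]] ?] // [[|[|n]] ?] //; rewrite !mxE.
- by congr (\det _); apply/matrixP => -[[|[|m]] ?] // [[|[|n]] ?] //; rewrite !mxE.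
- by congr (\det _); apply/matrixP => -[[|[|m]] ?] // [[|[|n]] ?] //; rewrite !mxE.
Qed.

Lemma cowedge4 i j k l (u v w x : R * H * H) :
  cowedge [:: i; j; k; l] [:: u; v; w; x] =
  coframe i u * cowedge [:: j; k; l] [:: v; w; x]
  - coframe i v * cowedge [:: j; k; l] [:: u; w; x]
  + coframe i w * cowedge [:: j; k; l] [:: u; v; x]
  - coframe i x * cowedge [:: j; k; l] [:: u; v; w].
Proof.
rewrite {1}/cowedge (expand_det_row _ ord0) !big_ord_recl big_ord0 /cofactor /=.
rewrite !mxE /= addr0 /bump /= !addn0 expr0 expr1 sqrrN expr1n.
rewrite (_ : (-1) ^+ _ = -1 :> R); last by rewrite -signr_odd.
rewrite !mul1r !mulN1r !mulrN !addrA; congr (_ * _ - _ * _ + _ * _ - _ * _).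
- by congr (\det _); apply/matrixP => -[[|[|[|m]]] ?] // [[|[|[|n]]] ?] //; rewrite !mxE.
- by congr (\det _); apply/matrixP => -[[|[|[|m]]] ?] // [[|[|[|n]]] ?] //; rewrite !mxE.
- by congr (\det _); apply/matrixP => -[[|[|[|m]]] ?] // [[|[|[|n]]] ?] //; rewrite !mxE.
- by congr (\det _); apply/matrixP => -[[|[|[|m]]] ?] // [[|[|[|n]]] ?] //; rewrite !mxE.
Qed.

End Hopf.

Section Continuity.
Context {R : realType} {T : topologicalType}.
Local Notation H := 'rV[R]_4.
Implicit Types (f g : T -> H) (h k : T -> R).

Lemma ctsD h k : continuous h -> continuous k -> continuous (fun z => h z + k z).
Proof. by move=> hc kc z; apply: cvgD; [exact: hc|exact: kc]. Qed.
Lemma ctsB h k : continuous h -> continuous k -> continuous (fun z => h z - k z).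
Proof. by move=> hc kc z; apply: cvgB; [exact: hc|exact: kc]. Qed.
Lemma ctsM h k : continuous h -> continuous k -> continuous (fun z => h z * k z).
Proof. by move=> hc kc z; apply: cvgM; [exact: hc|exact: kc]. Qed.
Lemma ctsN h : continuous h -> continuous (fun z => - h z).
Proof. by move=> hc z; apply: cvgN; exact: hc. Qed.
Lemma ctsC (c : R) : continuous ((fun=> c) : T -> R).
Proof. by move=> z; exact: cvg_cst. Qed.

Lemma cts_qc f n : continuous f -> continuous (fun z => qc (f z) n).
Proof.
move=> fc z; apply: (continuous_comp (f := f) (g := fun x : H => qc x n)).
  exact: fc.
exact: qc_continuous.
Qed.

Lemma cts_ext h k : h =1 k -> continuous k -> continuous h.
Proof. by move=> /funext ->. Qed.

Lemma cts_quat (h0 h1 h2 h3 : T -> R) : continuous h0 -> continuous h1 ->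
  continuous h2 -> continuous h3 ->
  continuous (fun z => quat (h0 z) (h1 z) (h2 z) (h3 z)).
Proof.
move=> c0 c1 c2 c3; apply: coord_cts; apply: forall4.
- by apply: (cts_ext _ c0) => z; rewrite qcE.
- by apply: (cts_ext _ c1) => z; rewrite qcE.
- by apply: (cts_ext _ c2) => z; rewrite qcE.
- by apply: (cts_ext _ c3) => z; rewrite qcE.
Qed.

Lemma cts_mulq f g : continuous f -> continuous g ->
  continuous (fun z => mulq (f z) (g z)).
Proof.
move=> fc gc.
have m i j : continuous (fun z => qc (f z) i * qc (g z) j).
  by apply: ctsM; exact: cts_qc.
apply: cts_quat.
- exact: (ctsB (ctsB (ctsB (m 0 0) (m 1 1)) (m 2 2)) (m 3 3)).
- exact: (ctsB (ctsD (ctsD (m 0 1) (m 1 0)) (m 2 3)) (m 3 2)).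
- exact: (ctsD (ctsD (ctsB (m 0 2) (m 1 3)) (m 2 0)) (m 3 1)).
- exact: (ctsD (ctsB (ctsD (m 0 3) (m 1 2)) (m 2 1)) (m 3 0)).
Qed.

Lemma cts_conjq f : continuous f -> continuous (fun z => conjq (f z)).
Proof.
by move=> fc; apply: cts_quat; rewrite -?/(continuous _); [exact: cts_qc|..];
  apply: ctsN; exact: cts_qc.
Qed.

Lemma cts_dotIm f g : continuous f -> continuous g ->
  continuous (fun z => dotIm (f z) (g z)).
Proof.
move=> fc gc.
have m i j : continuous (fun z => qc (f z) i * qc (g z) j).
  by apply: ctsM; exact: cts_qc.
exact: (ctsD (ctsD (m 1 1) (m 2 2)) (m 3 3)).
Qed.

Lemma cts_hopf f : continuous f -> continuous (fun z => hopf (f z)).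
Proof.
move=> fc; apply: cts_mulq; first exact: cts_conjq.
by apply: (cts_mulq (f := fun=> qi)) => // z; exact: cvg_cst.
Qed.

End Continuity.

Section MultiMoment.
Context {R : realType} {a : R}.
Local Notation H := 'rV[R]_4.
Local Notation s3 := (Num.sqrt 3 : R).

Lemma base_numu_collapse (z w : base R a) : collapse z w -> base_numu z = base_numu w.
Proof.
move=> /asboolP[->//|[z0 wz [l [w1 w2]]]]; rewrite /base_numu wz z0 subrr /=.
rewrite !(mulr0, mul0r) w1 w2; congr point4; congr (_ * _).
by apply/esym/dotIm_hopf; rewrite normq2J S3P.
Qed.

Definition spin_numu (x : spin_bundle a) : 'rV[R]_4 := base_numu (repr x).

Lemma spin_numuE z : spin_numu (\pi_(spin_bundle a) z) = base_numu z.
Proof. by apply/esym/base_numu_collapse/repr_spin. Qed.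

Lemma qc_point4 (x y u v : R) :
  (qc (point4 x y u v) 0 = x) * (qc (point4 x y u v) 1 = y) *
  (qc (point4 x y u v) 2 = u) * (qc (point4 x y u v) 3 = v).
Proof. exact: qcE. Qed.

Lemma base_numu_continuous : continuous (@base_numu R a).
Proof.
have comp (T U W : topologicalType) (f : T -> U) (g : U -> W) :
    continuous f -> continuous g -> continuous (fun z => g (f z)).
  by move=> fc gc z; apply: continuous_comp; [exact: fc|exact: gc].
have fstc (T U : topologicalType) : continuous (@fst T U) by move=> z; exact: cvg_fst.
have sndc (T U : topologicalType) : continuous (@snd T U) by move=> z; exact: cvg_snd.
have vc (T : topologicalType) (A : set T) : continuous (val : set_type A -> T).
  exact: initial_continuous.
have rc : continuous (fun z : base R a => val z.1.1 : R).
  apply: (comp _ _ _ (fun z : base R a => z.1.1) val); last exact: vc.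
  by apply: (comp _ _ _ fst fst); exact: fstc.
have pc : continuous (fun z : base R a => val z.1.2 : H).
  apply: (comp _ _ _ (fun z : base R a => z.1.2) val); last exact: vc.
  by apply: (comp _ _ _ fst snd); [exact: fstc|exact: sndc].
have qqc : continuous (fun z : base R a => val z.2 : H).
  by apply: (comp _ _ _ (fun z : base R a => z.2) val); [exact: sndc|exact: vc].
have r3c k : continuous (fun z : base R a => val z.1.1 ^+ 3 - k : R).
  by apply: ctsB; [apply: ctsM => //; exact: ctsM|exact: ctsC].
have hp := cts_hopf pc; have hq := cts_hopf qqc.
have ic (x : H) : continuous ((fun=> x) : base R a -> H) by move=> z; exact: cvg_cst.
apply: cts_quat.
- apply: ctsM; first by apply: ctsM; [exact: ctsC|exact: r3c].
  exact: (cts_dotIm hq (ic qi)).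
- apply: ctsM; first by apply: ctsM; [exact: ctsC|exact: r3c].
  exact: (cts_dotIm hp (ic qi)).
- apply: ctsM; first by apply: ctsM; [exact: ctsC|exact: r3c].
  exact: (cts_dotIm hp hq).
- apply: ctsM; first by apply: ctsM; [apply: ctsM; [exact: ctsC|exact: rc]|exact: r3c].
  apply: ctsB; apply: ctsM.
  + exact: (cts_dotIm hp (ic qj)).
  + exact: (cts_dotIm hq (ic qk)).
  + exact: (cts_dotIm hp (ic qk)).
  + exact: (cts_dotIm hq (ic qj)).
Qed.

Lemma spin_numu_continuous : continuous spin_numu.
Proof.
apply/quotient_continuous.
rewrite (_ : spin_numu \o _ = @base_numu R a); first exact: base_numu_continuous.
by apply/funext => z; exact: spin_numuE.
Qed.



Lemma phiE (b r : R) (u v w : R * H * H) : phi b r u v w =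
  - (4 / (3 * s3)) * b *
    (cowedge [:: 1; 2; 3]%N [:: u; v; w] - cowedge [:: 4; 5; 6]%N [:: u; v; w])
  + r ^+ 2 * (u.1.1 * sigma v w - v.1.1 * sigma u w + w.1.1 * sigma u v)
  - 3^-1 * (r ^+ 3 - b) *
    (sigma (bracket u v) w - sigma (bracket u w) v + sigma (bracket v w) u).
Proof.
have d (K : R) : 'D_1 (fun s : R => 3^-1 * (s ^+ 3 - b) * K) r = r ^+ 2 * K.
  have h : is_derive r 1 (fun s : R => 3^-1 * (s ^+ 3 - b) * K) (r ^+ 2 * K).
    by apply: is_derive_eq; rewrite /GRing.scale /=; field.
  by have [_ ->] := h.
rewrite /phi /ext_d !d; ring.
Qed.

Lemma coframe_bracket (u v : R * H * H) :
  let b i j := - 2 * (coframe i u * coframe j v - coframe j u * coframe i v) in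
  (coframe 1 (bracket u v) = b 2 3) * (coframe 2 (bracket u v) = b 3 1) *
  (coframe 3 (bracket u v) = b 1 2) * (coframe 4 (bracket u v) = b 5 6) *
  (coframe 5 (bracket u v) = b 6 4) * (coframe 6 (bracket u v) = b 4 5).
Proof. by rewrite /coframe /bracket /= !(qcD, qcN, qcE); do !split; ring. Qed.

Lemma coframe_triple (t : R) (x y : H) :
  (coframe 0 (t, x, y) = t) * (coframe 1 (t, x, y) = qc x 1) *
  (coframe 2 (t, x, y) = qc x 2) * (coframe 3 (t, x, y) = - qc x 3) *
  (coframe 4 (t, x, y) = qc y 1) * (coframe 5 (t, x, y) = qc y 2) *
  (coframe 6 (t, x, y) = - qc y 3).
Proof. by []. Qed.

Lemma phi_contractions (r rho : R) (A B x y : H) :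
  let k := 2 / (9 * s3) in let U1 := (0, A, 0) in let U2 := (0, 0, B) in
  let U3 := (0, - qi, - qi) in let w := (rho, x, y) in
  let dA := mulq A x - mulq x A in let dB := mulq B y - mulq y B in
  [/\ phi a r U2 U3 w = k * ((3 * r ^+ 2 * rho) * dotIm B qi
                              + (r ^+ 3 - 4 * a) * dotIm dB qi),
      phi a r U3 U1 w = k * ((3 * r ^+ 2 * rho) * dotIm A qi
                              + (r ^+ 3 - 4 * a) * dotIm dA qi) &
      phi a r U1 U2 w = k * ((3 * r ^+ 2 * rho) * dotIm A B
                              + (r ^+ 3 - a) * (dotIm dA B + dotIm A dB))].
Proof.
have s30 : s3 != 0 by rewrite sqrtr_eq0 -ltNge.
split; rewrite phiE /sigma !cowedge3 !cowedge2 !coframe_bracket !coframe_triple;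
  rewrite !(qcN, qc0) /dotIm !(qcD, qcN, qcE) /=;
  rewrite !(oppr0, mul0r, mulr0, addr0, add0r, subr0, sub0r) !invfM;
  by move: (s3^-1) => c; field.
Qed.

Lemma star_phi_contraction (r rho : R) (A B x y : H) :
  let U1 := (0, A, 0) in let U2 := (0, 0, B) in
  let U3 := (0, - qi, - qi) in let w := (rho, x, y) in
  let dA := mulq A x - mulq x A in let dB := mulq B y - mulq y B in
  star_phi a r U1 U2 U3 w =
    2 / 27 * ((4 * r ^+ 3 - 4 * a) * rho *
                (dotIm A qj * dotIm B qk - dotIm A qk * dotIm B qj)
              + r * (r ^+ 3 - 4 * a) *
                (dotIm dA qj * dotIm B qk + dotIm A qj * dotIm dB qk
                 - dotIm dA qk * dotIm B qj - dotIm A qk * dotIm dB qj)).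
Proof.
have s30 : s3 != 0 by rewrite sqrtr_eq0 -ltNge.
have s32 : (2 / (3 * s3)) * (2 / (3 * s3)) = 4 / 27.
  rewrite mulf_div (_ : _ * _ * (_ * _) = 9 * (s3 ^+ 2)); last by ring.
  by rewrite sqr_sqrtr ?ler0n //; field.
pose tau (u v : R * H * H) := cowedge [:: 1; 4]%N [:: u; v]
  + cowedge [:: 2; 5]%N [:: u; v] + cowedge [:: 3; 6]%N [:: u; v].
have sq u v w z : wedge22 sigma sigma u v w z = 4 / 27 * wedge22 tau tau u v w z.
  by rewrite -s32 /wedge22 /sigma /tau; ring.
rewrite /star_phi sq /wedge22 /wedge31 /psi_hat /tau !cowedge4 !cowedge3 !cowedge2.
rewrite !coframe_triple !(qcN, qc0) !(mulr0, mul0r, oppr0, subr0, sub0r, addr0, add0r).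
rewrite /dotIm !(qcD, qcN, qcE).
by rewrite !(oppr0, mul0r, mulr0, addr0, add0r, subr0, sub0r); field.
Qed.

Lemma spin_numu_diff (c : R -> base R a) (v : R * H * H) :
  off_zero (c 0) -> is_derive (0 : R) 1 (fun t => base_val (c t)) v ->
  forall n, is_derive (0 : R) 1
    (fun t => spin_numu (\pi_(spin_bundle a) (c t)) 0 n) (contraction (c 0) n v).
Proof.
move=> _ hc n; under eq_fun do rewrite spin_numuE.
have r' : is_derive (0 : R) 1 (fun t => val (c t).1.1 : R) v.1.1.
  exact: is_derive_fst (is_derive_fst hc).
have p' : is_derive (0 : R) 1 (fun t => val (c t).1.2 : H) v.1.2.
  exact: is_derive_snd (is_derive_fst hc).
have q' : is_derive (0 : R) 1 (fun t => val (c t).2 : H) v.2.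
  exact: is_derive_snd hc.
have p1 t : normq2 (val (c t).1.2) = 1 by exact: S3P.
have q1 t : normq2 (val (c t).2) = 1 by exact: S3P.
have /= A' := is_derive_hopf p1 p'.
have /= B' := is_derive_hopf q1 q'.
set x := mulq (conjq (val (c 0).1.2)) v.1.2 in A'.
set y := mulq (conjq (val (c 0).2)) v.2 in B'.
set A := hopf (val (c 0).1.2) in A'.
set B := hopf (val (c 0).2) in B'.
set r := val (c 0).1.1.
have T0 : left_triv (c 0) (U_field 0 (c 0)) = (0, A, 0).
  rewrite /left_triv /=; congr (_, _, _).
  by apply: quat_ext; rewrite !(qcE, qc0); ring.
have T1 : left_triv (c 0) (U_field 1 (c 0)) = (0, 0, B).
  rewrite /left_triv /=; congr (_, _, _).
  by apply: quat_ext; rewrite !(qcE, qc0); ring.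
have T2 : left_triv (c 0) (U_field 2 (c 0)) = (0, - qi, - qi).
  by rewrite /left_triv /= !mulqN !mulqA !mulJq p1 q1 !mul1q.
have Tv : left_triv (c 0) v = (v.1.1, x, y) by [].
have [P1 P2 P3] := phi_contractions r v.1.1 A B x y.
have P4 := star_phi_contraction r v.1.1 A B x y.
have C (z : H) : is_derive (0 : R) 1 (fun=> z) 0 by exact: is_derive_cst.
have Bi := is_derive_dotIm B' (C qi); have Ai := is_derive_dotIm A' (C qi).
have AB := is_derive_dotIm A' B'.
have Aj := is_derive_dotIm A' (C qj); have Ak := is_derive_dotIm A' (C qk).
have Bj := is_derive_dotIm B' (C qj); have Bk := is_derive_dotIm B' (C qk).
have d0 (u : H) : dotIm u 0 = 0 by rewrite /dotIm !qc0 !mulr0 !addr0.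
rewrite /contraction T0 T1 T2 Tv -/r -[n]inord_val.
have E z m : base_numu z 0 (inord m) = qc (@base_numu R a z) m by [].
under eq_fun do rewrite E.
have := ltn_ord n; case: (val n) => [|[|[|[|//]]]] _; rewrite inordK //=.
- under eq_fun do rewrite qc_point4 -/(hopf _).
  rewrite P1; apply: is_derive_eq; rewrite /GRing.scale /= d0 -/r -/B; ring.
- under eq_fun do rewrite qc_point4 -/(hopf _).
  rewrite P2; apply: is_derive_eq; rewrite /GRing.scale /= d0 -/r -/A; ring.
- under eq_fun do rewrite qc_point4 -!/(hopf _).
  rewrite P3; apply: is_derive_eq; rewrite /GRing.scale /= -/r -/A -/B; ring.
- under eq_fun do rewrite qc_point4 -!/(hopf _).
  rewrite P4; apply: is_derive_eq; rewrite /GRing.scale /= !d0 -/r -/A -/B; ring.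
Qed.

End MultiMoment.

(* The multi-moment map (nu_1, nu_2, nu_3, mu) of M. *)
Definition numu {R : realType} (a : R) : multi_moment a :=
  MultiMoment (@spin_numu_continuous R a) (@spin_numu_diff R a).

Section GeneratorLemmas.
Context {R : realType} {a : R}.
Local Notation H := 'rV[R]_4.
Implicit Types (z : base R a).

Lemma mulqZr (k : R) (x y : H) : mulq x (k *: y) = k *: mulq x y.
Proof. by apply: quat_ext; rewrite !(qcZ, qcE); ring. Qed.
Lemma mulqZl (k : R) (x y : H) : mulq (k *: x) y = k *: mulq x y.
Proof. by apply: quat_ext; rewrite !(qcZ, qcE); ring. Qed.

Lemma mulq0 (x : H) : mulq x 0 = 0.
Proof. by rewrite -(scale0r (0 : H)) mulqZr !scale0r. Qed.
Lemma mul0q (x : H) : mulq 0 x = 0.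
Proof. by rewrite -(scale0r (0 : H)) mulqZl !scale0r. Qed.
Lemma conjq0 : conjq 0 = 0 :> H.
Proof. by apply: quat_ext; rewrite !(qcE, qc0) ?oppr0. Qed.
Lemma conjq1 : conjq (quat 1 0 0 0) = quat 1 0 0 0 :> H.
Proof. by apply: quat_ext; rewrite !(qcE, qc0) ?oppr0. Qed.
Lemma conjq_qi : conjq qi = - qi :> H.
Proof. by apply: quat_ext; rewrite !(qcE, qcN) ?oppr0. Qed.

Lemma base_triv_act h m l z :
  base_triv (sp1_act h m l z) =
  (mulq (mulq (val h) (base_triv z).1) (conjq (val m)),
   mulq (mulq (val m) (base_triv z).2) (conjq (val l))).
Proof.
rewrite /base_triv /= !conjqM conjqK; congr (_, _).
  rewrite !mulqA; congr mulq; congr mulq.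
  by rewrite -mulqA mulJq S3P mulq1.
by rewrite mulqZr mulqZl.
Qed.

Lemma is_derive_pair (f g : R -> H) (x : R) df dg :
  is_derive x 1 f df -> is_derive x 1 g dg ->
  is_derive x 1 (fun t => (f t, g t) : H * H) (df, dg).
Proof.
move=> [/derivable1_diffP fd <-] [/derivable1_diffP gd <-].
have pd : differentiable (fun t => (f t, g t) : H * H) x by exact: differentiable_pair.
apply: DeriveDef; first exact/derivable1_diffP.
by rewrite !deriveE // diff_pair.
Qed.

Lemma is_derive_expi : is_derive (0 : R) 1 (fun t => val (expi t) : H) qi.
Proof.
apply: is_derive_coord; apply: forall4.
- under eq_fun do rewrite qcE.
  by apply: is_derive_eq; rewrite qcE sin0 oppr0.
- under eq_fun do rewrite qcE.
  by apply: is_derive_eq; rewrite qcE cos0.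
- by under eq_fun do rewrite qcE; rewrite qcE; exact: is_derive_cst.
- by under eq_fun do rewrite qcE; rewrite qcE; exact: is_derive_cst.
Qed.

Lemma generatorE z (j : 'I_3) : generator j (\pi_(spin_bundle a) z) =
  let g := (base_triv z).1 in let v := (base_triv z).2 in
  nth 0 [:: (mulq qi g, 0); (- mulq g qi, mulq qi v); (0, - mulq v qi)] j.
Proof.
set g := (base_triv z).1; set v := (base_triv z).2; move=> /=.
suff h : is_derive (0 : R) 1
    (fun t : R => spin_triv (torus_act (torus_exp j t) (\pi_(spin_bundle a) z)))
    (nth 0 [:: (mulq qi g, 0); (- mulq g qi, mulq qi v); (0, - mulq v qi)] j).
  by have [_] := h.
pose e n (t : R) : H := val (expi (if j == n :> nat then t else 0)).
pose de n : H := if j == n :> nat then qi else 0.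
have e' n : is_derive (0 : R) 1 (e n) (de n).
  rewrite /e /de; case: ifP => _; [exact: is_derive_expi|exact: is_derive_cst].
have -> : (fun t : R => spin_triv (torus_act (torus_exp j t) (\pi_(spin_bundle a) z))) =
    fun t => (mulq (mulq (e 0%N t) g) (conjq (e 1%N t)),
              mulq (mulq (e 1%N t) v) (conjq (e 2%N t))).
  by apply/funext => t; rewrite torus_actE spin_trivE base_triv_act.
have C (y : H) : is_derive (0 : R) 1 (fun=> y) 0 by exact: is_derive_cst.
have m n n' y : is_derive (0 : R) 1 (fun t => mulq (mulq (e n t) y) (conjq (e n' t)))
    (mulq (de n) y + mulq y (conjq (de n'))).
  have := is_derive_mulq (is_derive_mulq (e' n) (C y)) (is_derive_conjq (e' n')).
  have e0 k : e k 0 = quat 1 0 0 0.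
    by rewrite /e; case: ifP => _; rewrite /= cos0 sin0.
  rewrite !e0 => h; apply: (is_derive_eq h).
  by rewrite conjq1 !mulq1 !mulq0 !mul1q addr0.
apply: (is_derive_eq (is_derive_pair (m 0%N 1%N g) (m 1%N 2%N v))).
rewrite /de; case: j {e de e' m} => [[|[|[|//]]] ?] /=;
  by rewrite ?(conjq0, conjq_qi, mulqN, mulq0, mul0q, addr0, add0r).
Qed.

Lemma mulqI (x y : H) : normq2 x != 0 -> mulq x y = 0 -> y = 0.
Proof.
move=> x0 xy; have := congr1 (mulq (conjq x)) xy.
rewrite mulqA mulJq mulq0 (_ : quat _ _ _ _ = normq2 x *: quat 1 0 0 0); last first.
  by apply: quat_ext; rewrite !(qcZ, qcE) ?mulr1 ?mulr0.
by rewrite mulqZl mul1q => /eqP; rewrite scaler_eq0 (negPf x0) => /eqP.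
Qed.

Lemma sum3 (V : lmodType R) (c : 'rV[R]_3) (G : nat -> V) :
  \sum_(j < 3) c 0 j *: G j =
  c 0 ord0 *: G 0%N + (c 0 (lift ord0 ord0) *: G 1%N
                       + c 0 (lift ord0 (lift ord0 ord0)) *: G 2%N).
Proof. by rewrite !big_ord_recl big_ord0 addr0. Qed.

Lemma triv_dep (p q : H) (s k0 k1 k2 : R) :
  normq2 p = 1 -> normq2 q = 1 -> s != 0 ->
  k0 *: (mulq qi (mulq p (conjq q)), 0) +
    (k1 *: (- mulq (mulq p (conjq q)) qi, mulq qi (s *: q))
     + k2 *: (0, - mulq (s *: q) qi)) = 0 :> H * H <->
  k0 *: (0, mulq qi p, 0) +
    (k1 *: (0, 0, mulq qi q) + k2 *: (0, - mulq p qi, - mulq q qi))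
    = 0 :> R * H * H.
Proof.
move=> p1 q1 s0.
have ph (x : H) : normq2 x = 1 -> mulq qi x = mulq x (hopf x).
  by move=> x1; rewrite /hopf mulqA mulqJ x1 mul1q.
have E1 : k0 *: mulq qi (mulq p (conjq q)) + (k1 *: - mulq (mulq p (conjq q)) qi + k2 *: 0)
    = mulq p (mulq (k0 *: hopf p - k1 *: hopf q) (conjq q)).
  rewrite scaler0 addr0 mulqDl mulqDr mulNq mulqN !mulqZl !mulqZr scalerN.
  congr (_ *: _ - _ *: _); first by rewrite [RHS]mulqA -ph // mulqA.
  by rewrite /hopf -!mulqA mulqJ q1 mulq1.
have E2 : k0 *: 0 + (k1 *: mulq qi (s *: q) + k2 *: - mulq (s *: q) qi) =
    s *: mulq q (k1 *: hopf q - k2 *: qi).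
  rewrite scaler0 add0r mulqDr mulqN mulqZr mulqZl !mulqZr -ph // scalerBr scalerN.
  by rewrite !scalerA ![s * _]mulrC.
have E3 : k0 *: mulq qi p + (k1 *: 0 + k2 *: - mulq p qi) =
    mulq p (k0 *: hopf p - k2 *: qi).
  by rewrite scaler0 add0r mulqDr mulqN !mulqZr -ph // scalerN.
have E4 : k0 *: 0 + (k1 *: mulq qi q + k2 *: - mulq q qi) =
    mulq q (k1 *: hopf q - k2 *: qi).
  by rewrite scaler0 add0r mulqDr mulqN !mulqZr -ph // scalerN.
have inj (x y : H) : normq2 x = 1 -> mulq x y = 0 -> y = 0.
  by move=> x1; apply: mulqI; rewrite x1 oner_neq0.
split.
  move=> e; have := congr1 fst e; have := congr1 snd e.
  move=> /= e2 e1; move: e1 e2; rewrite E1 E2.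
  move=> /(inj _ _ p1) e1 /eqP; rewrite scaler_eq0 (negPf s0) /= => /eqP /(inj _ _ q1) e2.
  have {}e1 : k0 *: hopf p - k1 *: hopf q = 0.
    have := congr1 (fun y => mulq y q) e1.
    by rewrite -mulqA mulJq q1 mulq1 mul0q.
  have e3 : k0 *: hopf p - k2 *: qi = 0.
    by rewrite -(subrKA (k1 *: hopf q)) e1 e2 addr0.
  congr (_, _, _) => /=; rewrite ?E3 ?E4 ?e2 ?e3 ?mulq0 //.
  by rewrite /GRing.scale /= !mulr0 !addr0.
move=> e; have := congr1 (fun y => y.1.2) e; have := congr1 snd e.
move=> /= e2 e1; move: e1 e2; rewrite E3 E4 => /(inj _ _ p1) e1 /(inj _ _ q1) e2.
have e3 : k0 *: hopf p - k1 *: hopf q = 0.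
  by rewrite -(subrKA (k2 *: qi)) e1 -opprB e2 oppr0 addr0.
by congr (_, _) => /=; rewrite ?E1 ?E2 ?e2 ?e3 ?mul0q ?mulq0 ?scaler0.
Qed.

Lemma singular_point_off_zero z : off_zero z ->
  singular_point (\pi_(spin_bundle a) z) <->
  exists c : 'rV[R]_3, c != 0 /\ \sum_(j < 3) c 0 j *: U_field j z = 0.
Proof.
move=> z0.
suff h (c : 'rV[R]_3) : \sum_j c 0 j *: generator j (\pi_(spin_bundle a) z) = 0 <->
    \sum_(j < 3) c 0 j *: U_field j z = 0.
  by split=> -[c [c0 e]]; exists c; split=> //; apply/h.
rewrite (eq_bigr _ (fun j _ => congr1 (fun y => c 0 j *: y) (generatorE z j))) /=.
rewrite (sum3 c (fun j => U_field j z)).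
rewrite (sum3 c (fun j => nth 0 [:: (mulq qi (base_triv z).1, 0);
  (- mulq (base_triv z).1 qi, mulq qi (base_triv z).2);
  (0, - mulq (base_triv z).2 qi)] j)).
apply: triv_dep; [exact: S3P|exact: S3P|].
by rewrite sqrtr_eq0 -ltNge subr_gt0.
Qed.

Lemma singular_point_zero z :
  val z.1.1 ^+ 3 = 4 * a -> singular_point (\pi_(spin_bundle a) z).
Proof.
move=> z0; exists (delta_mx 0 ord_max); split.
  by apply/eqP => /rowP /(_ ord_max); rewrite !mxE eqxx => /eqP; rewrite oner_eq0.
rewrite (bigD1 ord_max) //= big1 => [|j /negPf jm]; last by rewrite mxE jm andbF scale0r.
rewrite mxE !eqxx scale1r addr0 generatorE /= /base_triv z0 subrr sqrtr0 scale0r.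
by rewrite mul0q oppr0.
Qed.

End GeneratorLemmas.

Definition homeomorphism (X Y : topologicalType) (f : X -> Y) : Prop :=
  continuous f /\ exists g : Y -> X, [/\ continuous g, cancel f g & cancel g f].

(* A finite graph embedded in X, possibly with unbounded edges.  A bounded edge *)
(* is parametrised by [0, 1] and joins two vertices; an unbounded one is        *)
(* parametrised by [0, +oo[, starts at a vertex and goes to infinity.           *)
Record embedded_graph (R : realType) (X : topologicalType) := EmbeddedGraph {
  vertices : seq X;
  edge : finType;
  bounded_edge : pred edge;
  edge_path : edge -> R -> X }.

Section Graphs.
Context {R : realType} {X : topologicalType} (G : embedded_graph R X).

Definition edge_dom (e : edge G) : set R :=
  if bounded_edge e then [set` `[0, 1]] else [set` `[0, +oo[].
Definition edge_interior (e : edge G) : set R :=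
  if bounded_edge e then [set` `]0, 1[] else [set` `]0, +oo[].

Definition carrier : set X :=
  [set` vertices G] `|` \bigcup_e (edge_path e @` edge_dom e).

Record is_graph : Prop := IsGraph {
  graph_vertices : uniq (vertices G);
  graph_continuous : forall e : edge G, {within edge_dom e, continuous (edge_path e)};
  graph_start : forall e : edge G, edge_path e 0 \in vertices G;
  graph_end : forall e : edge G, bounded_edge e -> edge_path e 1 \in vertices G;
  graph_proper : forall e : edge G, ~~ bounded_edge e ->
    forall K : set X, compact K -> \forall t \near +oo, ~ K (edge_path e t);
  graph_interior : forall (e : edge G) t,
    edge_interior e t -> edge_path e t \notin vertices G;
  graph_disjoint : forall (e e' : edge G) s t,
    edge_interior e s -> edge_interior e' t ->
    edge_path e s = edge_path e' t -> e = e' /\ s = t }.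

Definition degree (v : X) : nat :=
  (#|[pred e : edge G | edge_path e 0 == v]|
   + #|[pred e : edge G | bounded_edge e && (edge_path e 1 == v)]|)%N.

Definition trivalent : Prop := {in vertices G, forall v, degree v = 3%N}.

End Graphs.

(* The segment [None] and the four half-lines [Some (b1, b2)], where            *)
(* epsilon_i = (-1)^b_i.                                                        *)
Definition skeleton (R : realType) (k : R) : embedded_graph R 'rV[R]_4 :=
  EmbeddedGraph [:: point4 0 0 (- k) 0; point4 0 0 k 0]
    (fun e : option (bool * bool) => e == None)
    (fun e t => if e is Some (b1, b2) then
                  point4 ((-1) ^+ b1 * t) ((-1) ^+ b2 * t)
                         ((-1) ^+ b1 * (-1) ^+ b2 * (t + k)) 0
                else point4 0 0 ((2 * t - 1) * k) 0).

(* Main.v *)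
Require Import Defs.
From mathcomp Require Import all_boot all_order all_algebra.
From mathcomp Require Import all_classical all_reals all_analysis.
From mathcomp Require Import ring lra.
Import Order.TTheory GRing.Theory Num.Theory.
Import Defs.
Import numFieldNormedType.Exports.
Local Open Scope classical_set_scope.
Local Open Scope ring_scope.
Local Open Scope quotient_scope.

(** A point (r, p, q) enters the multi-moment map only through r and the two unit
    imaginary quaternions A = hopf p and B = hopf q, where hopf p is the conjugate
    of i by p; and of A and B only the numbers x = <A,i>, y = <B,i>, z = <A,B> and
    w = det (i, A, B) matter.  These satisfy one relation, [gram x y z w = 0]: the
    Gram determinant of i, A, B is the square of their determinant.

    Left multiplication by the circles does not change A and B, and right
    multiplication rotates both about i, so off the zero section the four numbers
    and r determine the torus orbit ([same_invariants_orbit]).  On the zero section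
    the collapsed point remembers only p q^-1, and z alone determines the orbit.

    It remains to recover r from (nu_1, nu_2, nu_3, mu).  For a fixed value of the
    map, increasing r multiplies x and y by one factor l, z by a larger factor
    m < 1, and w by some n < 1.  Under such a shrinking the invariants of unit
    vectors acquire gram > 0 ([gram_shrink]), so at most one r is possible
    ([radius_unique], [numu_inj]).  Conversely gram, with denominators cleared, is a
    polynomial in r that is nonpositive at the least r for which |x|, |y|, |z| <= 1
    and nonnegative for large r; a zero of it gives a preimage
    ([radius_exists], [base_numu_surjective]).

    The map is therefore a continuous bijection from the orbit space to R^4.  The
    relation gram = 0 prevents all of x, y, z, w from being small, so a bound on the
    map bounds r ([radius_bounded]); as the part of the total space with bounded r
    is compact, images of closed sets are closed and the inverse is continuous
    ([orbit_numu_homeomorphism]).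

    Off the zero section the three generating fields are dependent exactly when
    A and B both lie on the axis of i ([singular_off_zero]), which gives the half-lines
    with t > 0; the zero section, where the third circle acts trivially, gives the
    segment.  Injectivity shows that nothing else is mapped onto these sets
    ([singular_pointP]). *)

(** * The Gram determinant of three unit vectors *)

Set Implicit Arguments.
Unset Strict Implicit.
Unset Printing Implicit Defensive.

Section Gram.
Context {R : realType}.
Implicit Types (x y z w l m n : R).

(** The Gram determinant of three unit vectors with mutual inner products x, y, z,
    minus the square of their determinant w. *)
Definition gram x y z w : R :=
  1 - x ^+ 2 - y ^+ 2 - z ^+ 2 + 2 * x * y * z - w ^+ 2.

(** The increase of [gram] is (1 - n^2) w^2 plus an expression in x, y, z.
    Once x y z is replaced by |x||y||z|, the latter is a sum of nonnegative multiples of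
    squares and of P K with P = |x||y|, where K > 0 because l^2 < m < 1.  All terms
    vanish together only if x = y = z = w = 0, where [gram] is 1. *)
Lemma gram_shrink x y z w l m n :
  gram x y z w = 0 -> `|x| <= 1 -> `|y| <= 1 -> `|z| <= 1 ->
  0 <= l -> l < m -> m < 1 -> 0 <= n -> n < 1 ->
  0 < gram (l * x) (l * y) (m * z) (n * w).
Proof.
move=> g0 x1 y1 z1 l0 lm m1 n0 n1.
have m0 : 0 < m by exact: le_lt_trans lm.
have l1 : l < 1 by exact: lt_trans m1.
have ll1 : 0 < 1 - l ^+ 2 by rewrite subr_gt0 expr_lt1.
have nn1 : 0 < 1 - n ^+ 2 by rewrite subr_gt0 expr_lt1.
have mm1 : 0 < 1 - m ^+ 2 by rewrite subr_gt0 expr_lt1 // ltW.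
have llm : l ^+ 2 < m.
  by apply: le_lt_trans lm; rewrite expr2 ler_piMr // ltW.
have llm1 : 0 < 1 - l ^+ 2 * m.
  by rewrite subr_gt0 (le_lt_trans _ (lt_trans llm m1)) // ler_piMr ?exprn_ge0 // ltW.
pose X := `|x|; pose Y := `|y|; pose Z := `|z|; pose P := X * Y.
have P0 : 0 <= P by rewrite mulr_ge0 ?normr_ge0.
have P1 : P <= 1 by rewrite mulr_ile1 ?normr_ge0.
(* K is 2 (1 - l^2) + (1 - m^2) Z^2 - 2 (1 - l^2 m) Z, expanded in powers of 1 - Z. *)
pose K := (1 - m) * (1 + m - 2 * l ^+ 2) + 2 * (1 - Z) * m * (m - l ^+ 2)
  + (1 - m ^+ 2) * (1 - Z) ^+ 2.
have K0 : 0 < K.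
  rewrite /K -addrA; apply: ltr_pwDl; first by apply: mulr_gt0; rewrite ?subr_gt0 //; lra.
  apply: addr_ge0; last by rewrite mulr_ge0 ?sqr_ge0 // ltW.
  by rewrite !mulr_ge0 // ?subr_ge0 // ltW.
have xyz : x * y * z <= P * Z by rewrite (le_trans (ler_norm _)) // !normrM.
have sq (u : R) : u ^+ 2 = `|u| ^+ 2 by rewrite real_normK ?num_real.
have low : (1 - l ^+ 2) * (X - Y) ^+ 2 + (1 - P) * ((1 - m ^+ 2) * Z ^+ 2) + P * K
    + (1 - n ^+ 2) * w ^+ 2 <= gram (l * x) (l * y) (m * z) (n * w).
  rewrite -[leRHS]subr0 -g0 -subr_ge0.
  have -> : gram (l * x) (l * y) (m * z) (n * w) - gram x y z w -
   ((1 - l ^+ 2) * (X - Y) ^+ 2 + (1 - P) * ((1 - m ^+ 2) * Z ^+ 2) + P * K +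
    (1 - n ^+ 2) * w ^+ 2) = 2 * (1 - l ^+ 2 * m) * (P * Z - x * y * z).
    rewrite /gram /K !exprMn (sq x) (sq y) (sq z) -/X -/Y -/Z /P; ring.
  by rewrite mulr_ge0 ?mulr_ge0 ?ler0n ?subr_ge0 // ltW // -subr_gt0.
apply: lt_le_trans low.
have t1 : 0 <= (1 - l ^+ 2) * (X - Y) ^+ 2 by rewrite mulr_ge0 ?sqr_ge0 // ltW.
have t2 : 0 <= (1 - P) * ((1 - m ^+ 2) * Z ^+ 2).
  by apply: mulr_ge0; [rewrite subr_ge0|rewrite mulr_ge0 ?sqr_ge0 // ltW].
have t3 : 0 <= P * K by rewrite mulr_ge0 // ltW.
have t4 : 0 <= (1 - n ^+ 2) * w ^+ 2 by rewrite mulr_ge0 ?sqr_ge0 // ltW.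
rewrite lt0r !addr_ge0 // andbT.
rewrite paddr_eq0 ?addr_ge0 // paddr_eq0 ?addr_ge0 // paddr_eq0 //.
apply/negP => /andP[/andP[/andP[]]].
rewrite !(mulf_eq0 (1 - _)) (mulf_eq0 P) (gt_eqF ll1) (gt_eqF mm1) (gt_eqF K0).
rewrite (gt_eqF nn1) !expf_eq0 /= subr_eq0 orbF => /eqP XY e2 e3 /eqP w0.
rewrite /P mulf_eq0 in e3.
have X0 : X = 0 by move: e3; rewrite -XY orbb => /eqP.
have Y0 : Y = 0 by rewrite -XY.
move: e2; rewrite /P X0 mul0r subr0 oner_eq0 /= normr_eq0 => /eqP z0.
move/eqP: X0; move/eqP: Y0; rewrite !normr_eq0 => /eqP y0 /eqP x0.
move: g0; rewrite /gram x0 y0 z0 w0 => /eqP.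
by rewrite !(expr0n, mulr0, mul0r, subr0, addr0) oner_eq0.
Qed.

End Gram.

(** * The torus orbits in terms of the vectors hopf p and hopf q *)

Section Vectors.
Context {R : realType}.
Local Notation H := 'rV[R]_4.
Implicit Types (p q g A B : H) (t u v : R).

(** The determinant of i, A, B. *)
Definition tripleIm A B : R := dotIm A qj * dotIm B qk - dotIm A qk * dotIm B qj.

Lemma normq2_hopf p : normq2 p = 1 -> normq2 (hopf p) = 1.
Proof.
move=> p1; rewrite /hopf !normq2M normq2J p1 mul1r mulr1.
by rewrite /normq2 !qcE; ring.
Qed.

Lemma normq2_hopfS3 (p : S3 R) : normq2 (hopf (val p)) = 1.
Proof. by rewrite normq2_hopf // S3P. Qed.

Lemma mulqi_hopf p : normq2 p = 1 -> mulq qi p = mulq p (hopf p).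
Proof. by move=> p1; rewrite /hopf mulqA mulqJ p1 mul1q. Qed.

Lemma hopfM g p : hopf (mulq g p) = mulq (conjq p) (mulq (hopf g) p).
Proof. by rewrite /hopf conjqM !mulqA. Qed.

Lemma dotIm_le1 A B : qc A 0 = 0 -> qc B 0 = 0 -> normq2 A = 1 -> normq2 B = 1 ->
  `|dotIm A B| <= 1.
Proof.
move=> A0 B0; rewrite /normq2 A0 B0 => A1 B1.
rewrite -(expr_le1 (n := 2)) // real_normK ?num_real //.
(* Lagrange's identity for the cross product of A and B. *)
rewrite -[leRHS]mulr1 -{1}A1 -B1 -subr_ge0.
rewrite [leRHS](_ : _ = (qc A 2 * qc B 3 - qc A 3 * qc B 2) ^+ 2 +
  (qc A 3 * qc B 1 - qc A 1 * qc B 3) ^+ 2 + (qc A 1 * qc B 2 - qc A 2 * qc B 1) ^+ 2).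
  by rewrite !addr_ge0 ?sqr_ge0.
rewrite /dotIm; ring.
Qed.

Lemma gram_vectors A B : qc A 0 = 0 -> qc B 0 = 0 -> normq2 A = 1 -> normq2 B = 1 ->
  gram (dotIm A qi) (dotIm B qi) (dotIm A B) (tripleIm A B) = 0.
Proof.
move=> A0 B0; rewrite /normq2 A0 B0 => A1 B1.
(* Orthogonally to i, A and B have squared lengths 1 - x^2 and 1 - y^2, inner
   product z - x y and determinant w. *)
have A1' : qc A 2 ^+ 2 = 1 - qc A 1 ^+ 2 - qc A 3 ^+ 2 by rewrite -A1; ring.
have B1' : qc B 2 ^+ 2 = 1 - qc B 1 ^+ 2 - qc B 3 ^+ 2 by rewrite -B1; ring.
rewrite /gram /tripleIm /dotIm !qcE.
rewrite [LHS](_ : _ = (1 - qc A 1 ^+ 2) * (1 - qc B 1 ^+ 2)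
  - (qc A 2 ^+ 2 + qc A 3 ^+ 2) * (qc B 2 ^+ 2 + qc B 3 ^+ 2)); last by ring.
by rewrite A1' B1'; ring.
Qed.

(** Over the complex numbers: if |A| = |A'|, |B| = |B'| and the products of A and of A'
    with the conjugates of B and of B' agree, then the unit A'/A, or B'/B when A = 0
    (or 1 when B = 0 too), carries (A, B) to (A', B'). *)
Lemma rotation_plane a b c d a' b' c' d' :
  a ^+ 2 + b ^+ 2 = a' ^+ 2 + b' ^+ 2 -> c ^+ 2 + d ^+ 2 = c' ^+ 2 + d' ^+ 2 ->
  a * c + b * d = a' * c' + b' * d' -> a * d - b * c = a' * d' - b' * c' ->
  exists u v, u ^+ 2 + v ^+ 2 = 1 /\
    [/\ a' = u * a - v * b, b' = v * a + u * b,
        c' = u * c - v * d & d' = v * c + u * d] :> Prop.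
Proof.
wlog ab : a b c d a' b' c' d' / a ^+ 2 + b ^+ 2 != 0.
  move=> h e1 e2 e3 e4.
  have [ab|ab] := eqVneq (a ^+ 2 + b ^+ 2) 0; last exact: h.
  have zero (x y : R) : x ^+ 2 + y ^+ 2 = 0 -> x = 0 /\ y = 0.
    move/eqP; rewrite paddr_eq0 ?sqr_ge0 // !expf_eq0 /=.
    by move=> /andP[/eqP -> /eqP ->].
  have [a0 b0] := zero _ _ ab; have [a'0 b'0] := zero a' b' (etrans (esym e1) ab).
  have [cd|cd] := eqVneq (c ^+ 2 + d ^+ 2) 0.
    have [c0 d0] := zero _ _ cd; have [c'0 d'0] := zero c' d' (etrans (esym e2) cd).
    exists 1, 0; rewrite a0 b0 a'0 b'0 c0 d0 c'0 d'0.
    by split; [ring|split; ring].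
  have [||||u [v [uv [h1 h2 h3 h4]]]] := h c d a b c' d' a' b' cd => //.
  - by rewrite mulrC (mulrC d) e3 mulrC (mulrC d').
  - by rewrite (mulrC c) (mulrC d) -opprB e4; ring.
  - by exists u, v.
move=> e1 e2 e3 e4.
pose n := a ^+ 2 + b ^+ 2; have n0 : n != 0 by [].
exists ((a * a' + b * b') / n), ((a * b' - b * a') / n).
have quot x y : x * n = y -> x = y / n by move=> <-; rewrite mulfK.
split.
  rewrite [LHS](_ : _ = (n * (a' ^+ 2 + b' ^+ 2)) / n ^+ 2); last by rewrite /n; field.
  by rewrite -e1 -/n -expr2 divff // expf_neq0.
split.
- by rewrite -{1}[a'](mulfK n0) /n; field.
- by rewrite -{1}[b'](mulfK n0) /n; field.
- rewrite [RHS](_ : _ = (a' * (a * c + b * d) - b' * (a * d - b * c)) / n);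
    last by field.
  by apply: quot; rewrite e3 e4 /n e1; ring.
- rewrite [RHS](_ : _ = (b' * (a * c + b * d) + a' * (a * d - b * c)) / n);
    last by field.
  by apply: quot; rewrite e3 e4 /n e1; ring.
Qed.

Lemma circle_angle u v : u ^+ 2 + v ^+ 2 = 1 -> exists t, u = cos t /\ v = sin t.
Proof.
move=> uv.
have u1 : -1 <= u <= 1.
  rewrite -ler_norml -(expr_le1 (n := 2)) // real_normK ?num_real //.
  by rewrite -uv lerDl sqr_ge0.
have su : Num.sqrt (1 - u ^+ 2) = `|v|.
  by rewrite -uv addrAC subrr add0r sqrtr_sqr.
have cu : cos (acos u) = u by apply: acosK; rewrite in_itv.
have [v0|v0] := leP 0 v.
  by exists (acos u); rewrite cu sin_acos // su ger0_norm.
by exists (- acos u); rewrite cosN sinN cu sin_acos // su ltr0_norm // opprK.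
Qed.

Lemma rotation_qi A t :
  let c := cos (t + t) in let s := sin (t + t) in
  mulq (mulq (val (expi t)) A) (conjq (val (expi t))) =
  quat (qc A 0) (qc A 1) (c * qc A 2 - s * qc A 3) (s * qc A 2 + c * qc A 3).
Proof.
rewrite /= cosD sinD.
have c2 := cos2Dsin2 t.
apply: quat_ext; rewrite !qcE.
- by rewrite -[RHS]mulr1 -c2; ring.
- by rewrite -[RHS]mulr1 -c2; ring.
- by ring.
- by ring.
Qed.

Lemma rotation_qi_invariants A B t : qc A 0 = 0 -> qc B 0 = 0 ->
  let rot C := mulq (mulq (val (expi t)) C) (conjq (val (expi t))) in
  [/\ dotIm (rot A) qi = dotIm A qi, dotIm (rot A) (rot B) = dotIm A B
    & tripleIm (rot A) (rot B) = tripleIm A B].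
Proof.
move=> A0 B0 /=; rewrite !rotation_qi A0 B0.
have := cos2Dsin2 (t + t).
set c := cos _; set s := sin _ => c2.
rewrite /tripleIm /dotIm !qcE; split; first by ring.
- rewrite [LHS](_ : _ = qc A 1 * qc B 1
    + (c ^+ 2 + s ^+ 2) * (qc A 2 * qc B 2 + qc A 3 * qc B 3)); last by ring.
  by rewrite c2; ring.
- rewrite [LHS](_ : _ =
    (c ^+ 2 + s ^+ 2) * (qc A 2 * qc B 3 - qc A 3 * qc B 2)); last by ring.
  by rewrite c2; ring.
Qed.

Lemma hopf_act p t u :
  hopf (mulq (mulq (val (expi u)) p) (conjq (val (expi t)))) =
  mulq (mulq (val (expi t)) (hopf p)) (conjq (val (expi t))).
Proof.
rewrite hopfM conjqK mulqA; congr (mulq (mulq _ _) _).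
rewrite hopfM /hopf; congr mulq; congr mulq.
apply: quat_ext; rewrite /= !qcE.
- by ring.
- by rewrite -[RHS](cos2Dsin2 u); ring.
- by ring.
- by ring.
Qed.

(** The quotient of two points with the same image commutes with i, so it lies in the
    circle of i. *)
Lemma hopf_fiber p q : normq2 p = 1 -> normq2 q = 1 -> hopf p = hopf q ->
  exists t, q = mulq (val (expi t)) p.
Proof.
move=> p1 q1 pq; pose h := mulq q (conjq p).
have hqi : mulq h qi = mulq qi h.
  rewrite /h [RHS]mulqA mulqi_hopf // -pq /hopf -!mulqA; congr mulq; congr mulq.
  by rewrite mulqJ p1 mulq1.
have h1 : normq2 h = 1 by rewrite normq2M normq2J p1 q1 mulr1.
have h2 : qc h 2 = 0.
  have := congr1 (fun x => qc x 3) hqi; rewrite [LHS]qcE [RHS]qcE !qcE.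
  lra.
have h3 : qc h 3 = 0.
  have := congr1 (fun x => qc x 2) hqi; rewrite [LHS]qcE [RHS]qcE !qcE.
  lra.
have [|t [ct st]] := @circle_angle (qc h 0) (qc h 1).
  by rewrite -h1 /normq2 h2 h3; ring.
exists t; rewrite (_ : val (expi t) = h).
  by rewrite /h -mulqA mulJq p1 mulq1.
by apply: quat_ext; rewrite qcE.
Qed.

(** Right multiplication rotates both vectors about i, which realises the rotation given
    by [rotation_plane]; the circles on the left then act transitively on the fibres. *)
Lemma same_invariants_orbit p q p' q' :
  normq2 p = 1 -> normq2 q = 1 -> normq2 p' = 1 -> normq2 q' = 1 ->
  dotIm (hopf p) qi = dotIm (hopf p') qi -> dotIm (hopf q) qi = dotIm (hopf q') qi ->
  dotIm (hopf p) (hopf q) = dotIm (hopf p') (hopf q') ->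
  tripleIm (hopf p) (hopf q) = tripleIm (hopf p') (hopf q') ->
  exists t1 t2 t3,
    p' = mulq (mulq (val (expi t1)) p) (conjq (val (expi t3))) /\
    q' = mulq (mulq (val (expi t2)) q) (conjq (val (expi t3))).
Proof.
move=> p1 q1 p'1 q'1.
have [A EA] : exists A, hopf p = A by exists (hopf p).
have [B EB] : exists B, hopf q = B by exists (hopf q).
have [A' EA'] : exists A, hopf p' = A by exists (hopf p').
have [B' EB'] : exists B, hopf q' = B by exists (hopf q').
have := normq2_hopf p1; have := normq2_hopf q1; have := hopf_re p; have := hopf_re q.
have := normq2_hopf p'1; have := normq2_hopf q'1; have := hopf_re p'; have := hopf_re q'.
rewrite EA EB EA' EB' => B'0 A'0 B'1 A'1 B0 A0 B1 A1.
rewrite /tripleIm /dotIm !qcE !(mulr0, mulr1, addr0, add0r) => xE yE zE wE.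
have [| | | |u [v [uv [a b c d]]]] := @rotation_plane (qc A 2) (qc A 3) (qc B 2)
    (qc B 3) (qc A' 2) (qc A' 3) (qc B' 2) (qc B' 3).
- by move: A1 A'1; rewrite /normq2 A0 A'0 xE; lra.
- by move: B1 B'1; rewrite /normq2 B0 B'0 yE; lra.
- by move: zE; rewrite xE yE -!addrA => /addrI.
- by [].
have [s [cs ss]] := circle_angle uv.
(* Conjugation by expi t rotates by the angle t + t. *)
pose t := s / 2; have tt : t + t = s by rewrite /t; field.
have AE : hopf (mulq p (conjq (val (expi t)))) = hopf p'.
  rewrite hopfM conjqK mulqA rotation_qi tt -cs -ss EA EA'.
  by apply: quat_ext; rewrite qcE ?A0.
have BE : hopf (mulq q (conjq (val (expi t)))) = hopf q'.
  rewrite hopfM conjqK mulqA rotation_qi tt -cs -ss EB EB'.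
  by apply: quat_ext; rewrite qcE ?B0.
have unit x : normq2 x = 1 -> normq2 (mulq x (conjq (val (expi t)))) = 1.
  by move=> x1; rewrite normq2M normq2J x1 S3P mulr1.
have [t1 e1] := hopf_fiber (unit _ p1) p'1 AE.
have [t2 e2] := hopf_fiber (unit _ q1) q'1 BE.
by exists t1, t2, t; rewrite -!mulqA.
Qed.

End Vectors.

(** * Injectivity of the multi-moment map on torus orbits *)

Section Orbits.
Context {R : realType} {a : R}.
Local Notation H := 'rV[R]_4.
Local Notation s3 := (Num.sqrt 3 : R).
Implicit Types (z w : base R a) (x : spin_bundle a).

Lemma tripleIm_qi (A : H) : tripleIm A qi = 0.
Proof. by rewrite /tripleIm /dotIm !qcE; ring. Qed.

Lemma hopf1 : hopf (quat 1 0 0 0) = qi :> H.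
Proof. by rewrite /hopf conjq1 mul1q mulq1. Qed.

Lemma point4_inj (x1 x2 x3 x4 y1 y2 y3 y4 : R) :
  point4 x1 x2 x3 x4 = point4 y1 y2 y3 y4 -> [/\ x1 = y1, x2 = y2, x3 = y3 & x4 = y4].
Proof.
move=> e.
split; [have := congr1 (@qc R ^~ 0) e|have := congr1 (@qc R ^~ 1) e
  |have := congr1 (@qc R ^~ 2) e|have := congr1 (@qc R ^~ 3) e];
  by rewrite !qc_point4.
Qed.

Definition nu_scale : R := 2 / (9 * s3).

Lemma nu_scale_gt0 : 0 < nu_scale.
Proof. by rewrite divr_gt0 ?mulr_gt0 ?ltr0n // sqrtr_gt0 ltr0n. Qed.

Lemma base_numuE z : let A := hopf (val z.1.2) in let B := hopf (val z.2) in
  let r := val z.1.1 in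
  base_numu z = point4 (nu_scale * (r ^+ 3 - 4 * a) * dotIm B qi)
    (nu_scale * (r ^+ 3 - 4 * a) * dotIm A qi)
    (nu_scale * (r ^+ 3 - a) * dotIm A B) (2 / 27 * r * (r ^+ 3 - 4 * a) * tripleIm A B).
Proof. by []. Qed.

Lemma gram_base z : let A := hopf (val z.1.2) in let B := hopf (val z.2) in
  gram (dotIm A qi) (dotIm B qi) (dotIm A B) (tripleIm A B) = 0.
Proof.
by apply: gram_vectors; rewrite ?hopf_re // normq2_hopfS3.
Qed.

Lemma base_numu_act (t1 t2 t3 : R) z :
  base_numu (sp1_act (expi t1) (expi t2) (expi t3) z) = base_numu z.
Proof.
rewrite 2!base_numuE /sp1_act /= !hopf_act.
have [xE zE wE] := rotation_qi_invariants t3 (hopf_re (val z.1.2)) (hopf_re (val z.2)).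
have [yE _ _] := rotation_qi_invariants t3 (hopf_re (val z.2)) (hopf_re (val z.2)).
by rewrite xE yE zE wE.
Qed.

Lemma spin_numu_orbit x x' : same_orbit x x' -> spin_numu x = spin_numu x'.
Proof.
rewrite -[x]reprK -[x']reprK => /same_orbitP[t1 [t2 [t3 ->]]].
by rewrite !spin_numuE base_numu_act.
Qed.

Hypothesis a0 : 0 < a.

Lemma radius_ge z : 4 * a <= val z.1.1 ^+ 3.
Proof. by case: z => -[[r /= rP] _] _; exact: set_mem rP. Qed.

Lemma radius_gt0 z : 0 < val z.1.1.
Proof.
rewrite ltNge; apply/negP => r0.
have := radius_ge z; rewrite leNgt (le_lt_trans (y := 0)) ?mulr_gt0 //.
by rewrite exprS mulr_le0_ge0 // sqr_ge0.
Qed.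

Lemma radius_gt z : a < val z.1.1 ^+ 3.
Proof. by apply: lt_le_trans (radius_ge z); move: a0; lra. Qed.

(** Two points with the same image and radii r < r' have invariants related as in
    [gram_shrink], with l and m the quotients of r^3 - 4a and r^3 - a at the two radii;
    here l < m since a > 0.  But [gram] vanishes at both points. *)
Lemma radius_unique z w : base_numu z = base_numu w -> val z.1.1 = val w.1.1.
Proof.
wlog rr : z w / val z.1.1 < val w.1.1.
  move=> h zw; have [rr|rr|//] := ltgtP (val z.1.1) (val w.1.1); first exact: h.
  by apply/esym/h.
set r := val z.1.1 in rr *; set r' := val w.1.1 in rr *.
have r0 : 0 < r := radius_gt0 z; have r'0 : 0 < r' := radius_gt0 w.
have s0 : 0 <= r ^+ 3 - 4 * a by rewrite subr_ge0 radius_ge.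
have rr3 : r ^+ 3 < r' ^+ 3 by rewrite ltr_pXn2r // nnegrE ltW.
have s'0 : 0 < r' ^+ 3 - 4 * a by rewrite (le_lt_trans s0) // ltrD2r.
have d0 : 0 < r ^+ 3 - a by rewrite subr_gt0 radius_gt.
have d'0 : 0 < r' ^+ 3 - a by rewrite subr_gt0 radius_gt.
pose l := (r ^+ 3 - 4 * a) / (r' ^+ 3 - 4 * a).
pose m := (r ^+ 3 - a) / (r' ^+ 3 - a).
pose n := r / r' * l.
have l0 : 0 <= l by rewrite divr_ge0 // ltW.
have l1 : l <= 1 by rewrite ler_pdivrMr // mul1r lerD2r ltW.
have lm : l < m.
  rewrite /l /m ltr_pdivrMr // mulrAC ltr_pdivlMr //.
  rewrite -subr_gt0 (_ : _ - _ = 3 * a * (r' ^+ 3 - r ^+ 3)); last by ring.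
  by rewrite !mulr_gt0 // subr_gt0.
have m1 : m < 1 by rewrite ltr_pdivrMr // mul1r ltrD2r.
have n0 : 0 <= n by rewrite mulr_ge0 ?divr_ge0 // ltW.
have n1 : n < 1.
  have r1 : r / r' < 1 by rewrite ltr_pdivrMr // mul1r.
  by apply: le_lt_trans r1; rewrite ler_piMr // divr_ge0 // ltW.
have qi1 : normq2 (qi : H) = 1 by rewrite /normq2 !qcE; ring.
have qi0 : qc (qi : H) 0 = 0 by rewrite qcE.
have bound (p : S3 R) : `|dotIm (hopf (val p)) qi| <= 1.
  by apply: dotIm_le1; rewrite ?hopf_re // normq2_hopfS3.
have := gram_base w; have := gram_base z => /= gz gw zw.
have := gram_shrink gz (bound _) (bound _)
  (dotIm_le1 (hopf_re _) (hopf_re _) (normq2_hopfS3 _) (normq2_hopfS3 _)) l0 lm m1 n0 n1.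
move: zw; rewrite 2!base_numuE -/r -/r' => /point4_inj[e1 e2 e3 e4].
have s'N := lt0r_neq0 s'0; have d'N := lt0r_neq0 d'0; have r'N := lt0r_neq0 r'0.
have cN := lt0r_neq0 nu_scale_gt0.
have cancel (k u v u' v' : R) : k != 0 -> v' != 0 -> k * v * u = k * v' * u' ->
    v / v' * u = u'.
  move=> k0 v'0 e; apply: (mulfI (mulf_neq0 k0 v'0)); rewrite -e; field.
  exact: v'0.
have -> : l * dotIm (hopf (val z.1.2)) qi = dotIm (hopf (val w.1.2)) qi.
  exact: cancel cN s'N e2.
have -> : l * dotIm (hopf (val z.2)) qi = dotIm (hopf (val w.2)) qi.
  exact: cancel cN s'N e1.
have -> : m * dotIm (hopf (val z.1.2)) (hopf (val z.2)) =
    dotIm (hopf (val w.1.2)) (hopf (val w.2)).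
  exact: cancel cN d'N e3.
have -> : n * tripleIm (hopf (val z.1.2)) (hopf (val z.2)) =
    tripleIm (hopf (val w.1.2)) (hopf (val w.2)).
  rewrite /n /l mulf_div; apply: (cancel (2 / 27)).
  - by rewrite mulf_neq0 // ?invr_eq0 pnatr_eq0.
  - exact: mulf_neq0.
  - by rewrite !(mulrA (2 / 27)).
by rewrite [X in 0 < X]gw ltxx.
Qed.

(** On the zero section only z = <A,B> is known.  There p and q are collapsed to
    g = p q^-1, and z is the i-component of hopf g, so [same_invariants_orbit] is applied
    to the pairs (g, 1), whose other invariants are constant. *)
Lemma numu_inj z w : base_numu z = base_numu w ->
  same_orbit (\pi_(spin_bundle a) z) (\pi_(spin_bundle a) w).
Proof.
move=> zw; have rr := radius_unique zw; move: zw; rewrite 2!base_numuE -rr.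
have cN := lt0r_neq0 nu_scale_gt0.
move=> /point4_inj[e1 e2 e3 e4].
have d0 : val z.1.1 ^+ 3 - a != 0.
  by rewrite lt0r_neq0 // subr_gt0 radius_gt.
have {}e3 := mulfI (mulf_neq0 cN d0) e3.
have [s0|s0] := eqVneq (val z.1.1 ^+ 3 - 4 * a) 0; last first.
  have kN : 2 / 27 * val z.1.1 * (val z.1.1 ^+ 3 - 4 * a) != 0.
    by rewrite !mulf_neq0 ?invr_eq0 ?pnatr_eq0 // lt0r_neq0 // radius_gt0.
  have [t1 [t2 [t3 [p' q']]]] := same_invariants_orbit (S3P z.1.2) (S3P z.2)
    (S3P w.1.2) (S3P w.2) (mulfI (mulf_neq0 cN s0) e2) (mulfI (mulf_neq0 cN s0) e1)
    e3 (mulfI kN e4).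
  apply/same_orbitP; exists t1, t2, t3; congr (\pi_(spin_bundle a) _).
  by case: w rr e1 e2 e3 e4 p' q' => [[r' p] q] /= rr _ _ _ _ p' q';
    congr (_, _, _); apply/val_inj.
pose g (y : base R a) := mulq (val y.1.2) (conjq (val y.2)).
have g1 y : normq2 (g y) = 1 by rewrite normq2M normq2J !S3P mulr1.
have one1 : normq2 (quat 1 0 0 0 : H) = 1 by rewrite /normq2 !qcE; ring.
have gE y : dotIm (hopf (g y)) qi = dotIm (hopf (val y.1.2)) (hopf (val y.2)).
  rewrite -hopf1 -(S3P y.2) -mulqJ /g dotIm_hopf // normq2J; exact: S3P.
have [||||t1 [t2 [t3 [g' e']]]] := same_invariants_orbit (g1 z) one1 (g1 w) one1.
- by rewrite !gE.
- by [].
- by rewrite hopf1 !gE.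
- by rewrite hopf1 !tripleIm_qi.
apply/same_orbitP; exists t1, t3, 0; apply/esym/pi_spinP/asboolP; right; split => /=.
- by apply/eqP; rewrite -subr_eq0 s0.
- exact/val_inj.
(* The element of Sp(1) collapsed over the zero section, read off from the second factor. *)
exists (mulS3 (invS3 w.2) (mulS3 (expi t3) z.2)).
rewrite expi0 invS31 !mulS31 !invS3M invS3K; split; apply/val_inj => /=.
- transitivity (mulq (g w) (val w.2)); last by rewrite g' /g !mulqA.
  by rewrite /g -mulqA mulJq S3P mulq1.
- have e1' : normq2 (quat (cos t3) (sin t3) 0 0 : H) = 1 := S3P (expi t3).
  rewrite !mulqA -(mulqA _ (sval z.2)) [mulq (sval z.2) _]mulqJ S3P mulq1.
  by rewrite mulqJ e1' mul1q.
Qed.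

End Orbits.

(** * Surjectivity of the multi-moment map *)

Section Surjectivity.
Context {R : realType}.
Local Notation H := 'rV[R]_4.
Implicit Types (x y z w r X Y Z W : R).

(** Since A^2 = -1, the quaternion p = 1 - i A satisfies i p = p A; its normalisation is a
    preimage of A, and for A = -i, where it vanishes, j is one. *)
Lemma hopf_surjective (A : H) : qc A 0 = 0 -> normq2 A = 1 ->
  exists p : S3 R, hopf (val p) = A.
Proof.
move=> A0 A1.
suff [p [p1 pA]] : exists p : H, normq2 p = 1 /\ hopf p = A.
  by exists (exist _ p (mem_set p1)).
have e : qc A 2 ^+ 2 = 1 - qc A 1 ^+ 2 - qc A 3 ^+ 2.
  by rewrite -A1 /normq2 A0; ring.
have [A1N|A1N] := eqVneq (1 + qc A 1) 0.
  have A1E : qc A 1 = -1 by apply/eqP; rewrite -addr_eq0 addrC A1N.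
  have : qc A 2 ^+ 2 + qc A 3 ^+ 2 == 0 by rewrite e A1E; apply/eqP; ring.
  rewrite paddr_eq0 ?sqr_ge0 // !expf_eq0 /= => /andP[/eqP A2 /eqP A3].
  exists qj; split; first by rewrite /normq2 !qcE; ring.
  by apply: quat_ext; rewrite !qcE ?A0 ?A1E ?A2 ?A3; ring.
have pos : 0 < 2 * (1 + qc A 1).
  rewrite mulr_gt0 // lt0r A1N /=.
  have : qc A 1 ^+ 2 <= 1.
    by rewrite -subr_ge0 (_ : _ - _ = qc A 2 ^+ 2 + qc A 3 ^+ 2) ?addr_ge0 ?sqr_ge0 // e; ring.
  rewrite -real_normK ?num_real // expr_le1 // ler_norml => /andP[+ _].
  by rewrite -subr_ge0 opprK addrC.
pose k := (Num.sqrt (2 * (1 + qc A 1)))^-1.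
have k2 : k ^+ 2 * (2 * (1 + qc A 1)) = 1.
  by rewrite /k exprVn sqr_sqrtr ?ltW // mulVf // lt0r_neq0.
have kk : k ^+ 2 * (1 + qc A 1) = 1 / 2 by lra.
exists (quat (k * (1 + qc A 1)) 0 (k * qc A 3) (- k * qc A 2)); split.
  rewrite /normq2 !qcE.
  rewrite [LHS](_ : _ = k ^+ 2 * ((1 + qc A 1) ^+ 2 + qc A 3 ^+ 2 + qc A 2 ^+ 2));
    last by ring.
  by rewrite e -[RHS]k2; ring.
apply: quat_ext; rewrite [LHS]qcE !qcE ?A0.
- by ring.
- rewrite [LHS](_ : _ = k ^+ 2 * ((1 + qc A 1) ^+ 2 - qc A 3 ^+ 2 - qc A 2 ^+ 2));
    last by ring.
  by rewrite e -[RHS]mulr1 -[X in _ = _ * X]k2; ring.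
- rewrite [LHS](_ : _ = k ^+ 2 * (2 * (1 + qc A 1)) * qc A 2); last by ring.
  by rewrite k2 mul1r.
- rewrite [LHS](_ : _ = k ^+ 2 * (2 * (1 + qc A 1)) * qc A 3); last by ring.
  by rewrite k2 mul1r.
Qed.

(** A is placed in the half-plane spanned by i and j, and B is solved for; the relation
    [gram x y z w = 0] says that the solution is a unit vector or,
    when A is parallel to i, that z = x y and w = 0. *)
Lemma vectors_of_gram x y z w : gram x y z w = 0 -> `|x| <= 1 -> `|y| <= 1 ->
  exists A B : H, [/\ qc A 0 = 0, qc B 0 = 0, normq2 A = 1 & normq2 B = 1] /\
    [/\ dotIm A qi = x, dotIm B qi = y, dotIm A B = z & tripleIm A B = w].
Proof.
move=> g x1 y1.
have g' : (z - x * y) ^+ 2 + w ^+ 2 = (1 - x ^+ 2) * (1 - y ^+ 2).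
  by rewrite -[LHS]addr0 -g /gram; ring.
have pos (u : R) : `|u| <= 1 -> 0 <= 1 - u ^+ 2.
  by move=> u1; rewrite subr_ge0 -real_normK ?num_real // expr_le1.
pose al := Num.sqrt (1 - x ^+ 2).
have al2 : al ^+ 2 = 1 - x ^+ 2 by rewrite sqr_sqrtr ?pos.
have [al0|al0] := eqVneq al 0.
  have x2 : 1 - x ^+ 2 = 0 by rewrite -al2 al0 expr0n.
  have : (z - x * y) ^+ 2 + w ^+ 2 == 0 by rewrite g' x2 mul0r.
  rewrite paddr_eq0 ?sqr_ge0 // !expf_eq0 /= subr_eq0 => /andP[/eqP zE /eqP wE].
  exists (quat 0 x 0 0), (quat 0 y (Num.sqrt (1 - y ^+ 2)) 0).
  rewrite /normq2 /tripleIm /dotIm !qcE zE wE; split; split; try by ring.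
  - by rewrite -(subrK (x ^+ 2) 1) x2; ring.
  - by rewrite sqr_sqrtr ?pos //; ring.
exists (quat 0 x al 0), (quat 0 y ((z - x * y) / al) (w / al)).
rewrite /normq2 /tripleIm /dotIm !qcE; split; split; try by field.
- by rewrite al2; ring.
- rewrite [LHS](_ : _ = y ^+ 2 + ((z - x * y) ^+ 2 + w ^+ 2) / al ^+ 2); last by field.
  by rewrite g' -al2 mulrAC divff ?expf_neq0 //; ring.
Qed.

Lemma cube_root x : 0 <= x -> exists2 r, 0 <= r & r ^+ 3 = x.
Proof.
move=> x0; exists (x `^ 3^-1); first exact: powR_ge0.
by rewrite -powR_mulrn ?powR_ge0 // -powRrM mulVf ?powRr1 // pnatr_eq0.
Qed.

Variable a : R.
Hypothesis a0 : 0 < a.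
Local Notation c := (@nu_scale R).

(** (r S T)^2 times [gram] of the invariants that a point of radius r must have in order
    to be mapped to (Y, X, Z, W); see [gram_radial_poly].  The factors S and T are those
    of nu_1, nu_2 and of nu_3. *)
Definition radial_poly X Y Z W r : R :=
  let S := c * (r ^+ 3 - 4 * a) in let T := c * (r ^+ 3 - a) in
  r ^+ 2 * (S ^+ 2 * T ^+ 2 - (X ^+ 2 + Y ^+ 2) * T ^+ 2 - Z ^+ 2 * S ^+ 2
            + 2 * X * Y * Z * T) - 3 * W ^+ 2 * T ^+ 2.

Lemma radial_poly_continuous X Y Z W : continuous (radial_poly X Y Z W).
Proof.
pose p : {poly R} :=
  let S := c%:P * ('X ^+ 3 - (4 * a)%:P) in let T := c%:P * ('X ^+ 3 - a%:P) in
  'X ^+ 2 * (S ^+ 2 * T ^+ 2 - (X ^+ 2 + Y ^+ 2)%:P * T ^+ 2 - (Z ^+ 2)%:P * S ^+ 2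
            + (2 * X * Y * Z)%:P * T) - (3 * W ^+ 2)%:P * T ^+ 2.
rewrite (_ : radial_poly X Y Z W = horner p); first exact: continuous_horner.
by apply/funext => r; rewrite /p /radial_poly !(hornerE, horner_exp).
Qed.

(** This relation between the normalisations of the nu_i and of mu makes the term in W of
    [radial_poly] free of denominators. *)
Lemma nu_scale_sqr : c ^+ 2 = 3 * (2 / 27) ^+ 2.
Proof.
rewrite /nu_scale exprMn exprVn exprMn sqr_sqrtr //; by field.
Qed.


(** When one of x, y, z is 1 or -1, two of the three vectors are parallel and [gram] is
    minus a sum of squares. *)
Lemma radial_poly_le0 X Y Z W r :
  let S := c * (r ^+ 3 - 4 * a) in let T := c * (r ^+ 3 - a) in
  [\/ S ^+ 2 = X ^+ 2, S ^+ 2 = Y ^+ 2 | T ^+ 2 = Z ^+ 2] ->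
  radial_poly X Y Z W r <= 0.
Proof.
move=> S T h; rewrite /radial_poly -/S -/T.
suff : S ^+ 2 * T ^+ 2 - (X ^+ 2 + Y ^+ 2) * T ^+ 2 - Z ^+ 2 * S ^+ 2
    + 2 * X * Y * Z * T <= 0.
  move=> h'; rewrite subr_le0; apply: (@le_trans _ _ 0).
    by rewrite mulr_ge0_le0 ?sqr_ge0.
  by rewrite -mulrA -exprMn mulr_ge0 // sqr_ge0.
case: h => e.
- rewrite e [leLHS](_ : _ = - (Y * T - X * Z) ^+ 2); last by ring.
  by rewrite oppr_le0 sqr_ge0.
- rewrite e [leLHS](_ : _ = - (X * T - Y * Z) ^+ 2); last by ring.
  by rewrite oppr_le0 sqr_ge0.
- have /eqP := e; rewrite eqf_sqr => /orP[/eqP ->|/eqP ->].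
    rewrite [leLHS](_ : _ = - (Z * (X - Y)) ^+ 2); last by ring.
    by rewrite oppr_le0 sqr_ge0.
  rewrite [leLHS](_ : _ = - (Z * (X + Y)) ^+ 2); last by ring.
  by rewrite oppr_le0 sqr_ge0.
Qed.

Lemma radial_poly_ge0 X Y Z W r : let N := `|X| + `|Y| + `|Z| + `|W| in
  1 <= r -> 4 * N <= c * (r ^+ 3 - 4 * a) -> 0 <= radial_poly X Y Z W r.
Proof.
move=> N r1; rewrite /radial_poly.
set S := c * (r ^+ 3 - 4 * a); set T := c * (r ^+ 3 - a) => NS.
have X0 := normr_ge0 X; have Y0 := normr_ge0 Y.
have Z0 := normr_ge0 Z; have W0 := normr_ge0 W.
have N0 : 0 <= N by rewrite !addr_ge0.
have ST : S <= T by rewrite ler_pM2l ?nu_scale_gt0 // lerD2l lerN2; move: a0; lra.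
clearbody S T.
have S0 : 0 <= S by rewrite (le_trans _ NS) // mulr_ge0.
have T0 : 0 <= T by exact: le_trans ST.
have sq (u : R) : `|u| <= N -> u ^+ 2 <= N ^+ 2.
  by move=> uN; rewrite -(real_normK (num_real u)) ler_pXn2r // nnegrE.
have XN : `|X| <= N by rewrite /N; lra.
have YN : `|Y| <= N by rewrite /N; lra.
have ZN : `|Z| <= N by rewrite /N; lra.
have WN : `|W| <= N by rewrite /N; lra.
clearbody N.
have NT : N <= T by lra.
have SN : 16 * N ^+ 2 <= S ^+ 2.
  have -> : 16 * N ^+ 2 = (4 * N) ^+ 2 by ring.
  by rewrite ler_pXn2r // nnegrE mulr_ge0.
have tr : - (2 * X * Y * Z * T) <= 2 * N ^+ 2 * T ^+ 2.
  have XY : `|X| * `|Y| <= N ^+ 2 by rewrite expr2 ler_pM.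
  have ZT : `|Z| * T <= T ^+ 2 by rewrite expr2 ler_wpM2r // (le_trans ZN).
  rewrite (le_trans (ler_norm _)) // normrN !normrM (ger0_norm T0) normr_nat.
  have -> : 2 * `|X| * `|Y| * `|Z| * T = 2 * ((`|X| * `|Y|) * (`|Z| * T)) by ring.
  by rewrite -[leRHS]mulrA ler_pM2l // ler_pM // mulr_ge0.
have T2 := sqr_ge0 T; have S2 := sqr_ge0 S.
have t1 : (X ^+ 2 + Y ^+ 2) * T ^+ 2 <= 2 * N ^+ 2 * T ^+ 2.
  by rewrite ler_wpM2r // mulr_natl mulr2n lerD // sq.
have t2 : Z ^+ 2 * S ^+ 2 <= N ^+ 2 * T ^+ 2.
  by rewrite ler_pM ?sqr_ge0 ?sq // ler_pXn2r // nnegrE.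
have t3 : 3 * W ^+ 2 * T ^+ 2 <= 3 * N ^+ 2 * T ^+ 2.
  by rewrite ler_wpM2r // ler_pM2l // sq.
have t4 : 16 * N ^+ 2 * T ^+ 2 <= S ^+ 2 * T ^+ 2 by rewrite ler_wpM2r.
have N2T2 : 0 <= N ^+ 2 * T ^+ 2 by rewrite -exprMn sqr_ge0.
rewrite subr_ge0.
set B := _ + 2 * X * Y * Z * T.
have B3 : 3 * N ^+ 2 * T ^+ 2 <= B by rewrite /B; lra.
have B0 : 0 <= B by rewrite (le_trans _ B3) // -mulrA mulr_ge0.
rewrite (le_trans t3) // (le_trans B3) // ler_peMl // expr_ge1 // (le_trans _ r1) //.
Qed.

Lemma gram_radial_poly X Y Z W r (S := c * (r ^+ 3 - 4 * a))
    (T := c * (r ^+ 3 - a)) (V := 2 / 27 * r * (r ^+ 3 - 4 * a)) :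
  r != 0 -> S != 0 -> T != 0 ->
  gram (X / S) (Y / S) (Z / T) (W / V) = radial_poly X Y Z W r / (r * S * T) ^+ 2.
Proof.
move=> r0 S0 T0.
have c0 : c != 0 by rewrite gt_eqF ?nu_scale_gt0.
have V2 : (r * S) ^+ 2 = 3 * V ^+ 2.
  rewrite [LHS](_ : _ = (r * (r ^+ 3 - 4 * a)) ^+ 2 * c ^+ 2); last by rewrite /S; ring.
  by rewrite nu_scale_sqr /V; ring.
have V0 : V != 0.
  by apply: contra_neq (mulf_neq0 r0 S0) => V0; apply/eqP;
    rewrite -sqrf_eq0 V2 V0 expr0n mulr0.
rewrite /radial_poly -/S -/T /gram.
have -> : (W / V) ^+ 2 = 3 * W ^+ 2 / (r * S) ^+ 2 by rewrite V2; field.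
by field; rewrite r0 S0 T0.
Qed.

(** The intermediate value theorem for [radial_poly] starts at the least radius r1 for
    which |x|, |y|, |z| <= 1.  A zero with r^3 = 4a forces X = Y = W = 0, and then the map
    does not constrain x, y and w: x = y = 0 is taken. *)
Lemma radius_exists X Y Z W : exists r x y z w,
  [/\ 4 * a <= r ^+ 3, gram x y z w = 0, `|x| <= 1 & `|y| <= 1] /\
  [/\ c * (r ^+ 3 - 4 * a) * x = X, c * (r ^+ 3 - 4 * a) * y = Y,
      c * (r ^+ 3 - a) * z = Z & 2 / 27 * r * (r ^+ 3 - 4 * a) * w = W].
Proof.
have c0 := @nu_scale_gt0 R; have cN := lt0r_neq0 c0.
have radius (s : R) : 0 <= s -> exists2 r, 0 <= r & c * (r ^+ 3 - 4 * a) = s.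
  move=> s0; have [|r r0 re] := @cube_root (s / c + 4 * a).
    by apply: addr_ge0; [rewrite divr_ge0 // ltW|rewrite mulr_ge0 // ltW].
  by exists r => //; rewrite re addrK mulrCA divff // mulr1.
pose k := c * (3 * a).
have TE r : c * (r ^+ 3 - a) = c * (r ^+ 3 - 4 * a) + k by rewrite /k; ring.
(* The value of c (r^3 - 4 a) at the least admissible radius. *)
pose s := Num.max (Num.max `|X| `|Y|) (`|Z| - k).
have sX : `|X| <= s by rewrite !le_max lexx.
have sY : `|Y| <= s by rewrite !le_max lexx orbT.
have sZ : `|Z| - k <= s by rewrite le_max lexx orbT.
have s0 : 0 <= s by exact: le_trans sX.
have [r1 r10 r1E] := radius s s0.
pose N := `|X| + `|Y| + `|Z| + `|W|.
have N0 : 0 <= N by rewrite !addr_ge0.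
have [|r2 r20 r2E] := radius (4 * N + c); first by rewrite addr_ge0 ?mulr_ge0 // ltW.
have k0 : 0 < k by rewrite !mulr_gt0.
have sN : s <= 4 * N.
  rewrite !ge_max /N; have := normr_ge0 X; have := normr_ge0 Y.
  have := normr_ge0 Z; have := normr_ge0 W => *; apply/andP; split.
    by apply/andP; split; lra.
  by lra.
have cube_le (u v : R) : 0 <= u -> 0 <= v -> u ^+ 3 <= v ^+ 3 -> u <= v.
  by move=> u0 v0; rewrite ler_pXn2r // nnegrE.
have r12 : r1 <= r2.
  apply: cube_le => //; rewrite -(lerD2r (- (4 * a))) -(ler_pM2l c0) r1E r2E.
  by rewrite (le_trans sN) // lerDl ltW.
have r21 : 1 <= r2.
  apply: cube_le => //; rewrite expr1n -(lerD2r (- (4 * a))) -(ler_pM2l c0) r2E.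
  rewrite mulrBr mulr1 addrC lerD // (le_trans (y := 0)) //; last by rewrite mulr_ge0.
  by rewrite oppr_le0 mulr_ge0 ?mulr_ge0 // ltW.
have lo : radial_poly X Y Z W r1 <= 0.
  apply: radial_poly_le0; rewrite TE r1E.
  have sq (u v : R) : u = `|v| -> u ^+ 2 = v ^+ 2 by move=> ->; rewrite real_normK ?num_real.
  rewrite /s; case: (leP (Num.max `|X| `|Y|) (`|Z| - k)) => _.
    by apply: Or33; rewrite subrK; exact: sq.
  by case: (leP `|X| `|Y|) => _; [apply: Or32|apply: Or31]; exact: sq.
have hi : 0 <= radial_poly X Y Z W r2.
  by apply: radial_poly_ge0; rewrite ?r2E // lerDl ltW.
have [||r] := @IVT _ (radial_poly X Y Z W) r1 r2 0 r12.
- exact/continuous_subspaceT/radial_poly_continuous.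
- by rewrite ge_min lo /= le_max hi orbT.
rewrite in_itv /= => /andP[r1r _] re.
have rp : 0 <= r by exact: le_trans r1r.
have sr : s <= c * (r ^+ 3 - 4 * a).
  by rewrite -r1E ler_pM2l // lerD2r ler_pXn2r // nnegrE.
have ar : 4 * a <= r ^+ 3 by rewrite -subr_ge0 -(pmulr_rge0 _ c0) (le_trans s0).
have ar' : a < r ^+ 3 by move: a0; lra.
have T0 : 0 < c * (r ^+ 3 - a) by rewrite mulr_gt0 // subr_gt0.
have T0' := lt0r_neq0 T0.
have rN : r != 0.
  by apply: contraTneq ar' => ->; rewrite expr0n /= -leNgt ltW.
have [S0|S0] := eqVneq (r ^+ 3 - 4 * a) 0; last first.
  have SN : c * (r ^+ 3 - 4 * a) != 0 by rewrite mulf_neq0.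
  have Sp : 0 < c * (r ^+ 3 - 4 * a) by rewrite lt0r SN (le_trans s0).
  pose V := 2 / 27 * r * (r ^+ 3 - 4 * a).
  have VN : V != 0 by rewrite /V !mulf_neq0 ?invr_eq0 ?pnatr_eq0.
  exists r, (X / (c * (r ^+ 3 - 4 * a))), (Y / (c * (r ^+ 3 - 4 * a))),
    (Z / (c * (r ^+ 3 - a))), (W / V); split; split => //.
  + by rewrite gram_radial_poly // re mul0r.
  + by rewrite normrM normfV (gtr0_norm Sp) ler_pdivrMr // mul1r (le_trans sX).
  + by rewrite normrM normfV (gtr0_norm Sp) ler_pdivrMr // mul1r (le_trans sY).
  + by rewrite mulrCA divff ?mulr1.
  + by rewrite mulrCA divff ?mulr1.
  + by rewrite mulrCA divff ?mulr1.
  + by rewrite -/V mulrCA divff ?mulr1.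
have s00 : s = 0 by apply/eqP; rewrite eq_le s0 andbT (le_trans sr) // S0 mulr0.
have X0 : X = 0 by apply/eqP; rewrite -normr_le0 -s00.
have Y0 : Y = 0 by apply/eqP; rewrite -normr_le0 -s00.
have W0 : W = 0.
  move: re; rewrite /radial_poly S0 X0 Y0 => /eqP.
  rewrite (_ : _ - _ = - (3 * W ^+ 2 * (c * (r ^+ 3 - a)) ^+ 2)); last by ring.
  rewrite oppr_eq0 (mulf_eq0 (3 * _)) (mulf_eq0 3) !sqrf_eq0 (negPf T0') orbF.
  by rewrite pnatr_eq0 => /eqP.
have TEr := TE r; rewrite S0 mulr0 add0r in TEr.
have z1 : `|Z / (c * (r ^+ 3 - a))| <= 1.
  rewrite normrM normfV (gtr0_norm T0) ler_pdivrMr // mul1r TEr.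
  by rewrite -subr_le0 -s00.
exists r, 0, 0, (Z / (c * (r ^+ 3 - a))),
  (Num.sqrt (1 - (Z / (c * (r ^+ 3 - a))) ^+ 2)); split; split => //.
- rewrite /gram sqr_sqrtr; first by ring.
  by rewrite subr_ge0 -real_normK ?num_real // expr_le1.
- by rewrite normr0.
- by rewrite normr0.
- by rewrite mulr0.
- by rewrite mulr0.
- by rewrite mulrCA divff ?mulr1.
- by rewrite S0 mulr0 mul0r.
Qed.

Lemma base_numu_gram r x y z w : 4 * a <= r ^+ 3 -> gram x y z w = 0 ->
  `|x| <= 1 -> `|y| <= 1 -> exists b : base R a, val b.1.1 = r /\
    base_numu b = point4 (c * (r ^+ 3 - 4 * a) * y) (c * (r ^+ 3 - 4 * a) * x)
      (c * (r ^+ 3 - a) * z) (2 / 27 * r * (r ^+ 3 - 4 * a) * w).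
Proof.
move=> ar g x1 y1.
have [A [B [[A0 B0 A1 B1] [Ax By ABz ABw]]]] := vectors_of_gram g x1 y1.
have [p pA] := hopf_surjective A0 A1; have [q qB] := hopf_surjective B0 B1.
exists (exist _ r (mem_set ar), p, q); split=> //.
by rewrite base_numuE /= pA qB Ax By ABz ABw.
Qed.

Lemma base_numu_surjective (v : H) : exists z : base R a, base_numu z = v.
Proof.
have [r [x [y [z [w [[ar g x1 y1] [xE yE zE wE]]]]]]] :=
  radius_exists (qc v 1) (qc v 0) (qc v 2) (qc v 3).
have [b [_ bE]] := base_numu_gram ar g x1 y1.
by exists b; rewrite bE xE yE zE wE; apply: quat_ext; rewrite qc_point4.
Qed.

End Surjectivity.

(** * The inverse is continuous *)

Section GeneralTopology.

(** The subtype carries the initial topology, so a point of it is a cluster point of a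
    filter as soon as its image is one of the image filter. *)
Lemma set_type_compact (T : topologicalType) (A : set T) (K : set (set_type A)) :
  compact (val @` K) -> compact K.
Proof.
pose v : set_type A -> T := val.
have push F B : Filter F -> F B -> fmap v F (v @` B).
  by move=> FF FB; apply: (@filterS _ F FF B) FB => x Bx; exists x.
move=> cK F FF FK; have [_ [[k Kk <-] kF]] := cK (fmap v F) _ (push _ _ _ FK).
exists k; split=> // B U FB; rewrite nbhsE => -[V [[W oW <-] Vk] VU].
have [_ [[b Bb <-] Wb]] := kF _ _ (push _ _ _ FB) (open_nbhs_nbhs (conj oW Vk)).
by exists b; split=> //; exact: VU.
Qed.

(** Near a given point of V only the part of C inside one compact set matters, and the
    image of that part is compact, hence closed. *)
Lemma proper_closed_image (R : realType) (T : topologicalType)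
    (V : normedModType R) (f : T -> V) :
  continuous f ->
  (forall N, exists2 K, compact K & forall z, `|f z| <= N -> K z) ->
  forall C, closed C -> closed (f @` C).
Proof.
move=> fc prop C cC v cv.
have [K cK KP] := prop (`|v| + 1).
have cl : closed (f @` (K `&` C)).
  apply: compact_closed; first exact: norm_hausdorff.
  apply: continuous_compact; first exact: continuous_subspaceT.
  exact: compact_closedI.
suff : (f @` (K `&` C)) v by move=> [z [_ Cz] <-]; exists z.
apply: cl => U Uv.
have Bv : nbhs v (ball v (1 : R)) by exact: nbhsx_ballx.
have [_ [[z Cz <-] [Uz vz]]] := cv _ (filterI Uv Bv).
exists (f z); split=> //; exists z => //; split=> //; apply: KP.
rewrite -[f z](subrK v) (le_trans (ler_normD _ _)) // addrC lerD2l.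
by move: vz; rewrite -ball_normE /= distrC => /ltW.
Qed.

End GeneralTopology.

Section Homeo.
Context {R : realType} (a : R).
Local Notation H := 'rV[R]_4.
Hypothesis a0 : 0 < a.

Lemma sphere3_compact : compact (sphere3 R).
Proof.
apply: bounded_closed_compact.
  exists 1; split=> // N N1 x /= x1.
  rewrite [leLHS]mx_normrE (bigmax_le _ (ltW (le_lt_trans ler01 N1))) //= => -[i j] _ /=.
  have xj : x i j ^+ 2 <= 1.
    rewrite ord1 -[j]inord_val -[x _ _]/(qc x j) -x1 /normq2.
    have p n := sqr_ge0 (qc x n).
    by case: j => [[|[|[|[|//]]]] /= _]; rewrite -subr_ge0;
      [rewrite [leRHS](_ : _ = qc x 1 ^+ 2 + qc x 2 ^+ 2 + qc x 3 ^+ 2)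
      |rewrite [leRHS](_ : _ = qc x 0 ^+ 2 + qc x 2 ^+ 2 + qc x 3 ^+ 2)
      |rewrite [leRHS](_ : _ = qc x 0 ^+ 2 + qc x 1 ^+ 2 + qc x 3 ^+ 2)
      |rewrite [leRHS](_ : _ = qc x 0 ^+ 2 + qc x 1 ^+ 2 + qc x 2 ^+ 2)];
      rewrite ?addr_ge0 //; ring.
  apply: le_trans (ltW N1).
  by rewrite -(expr_le1 (n := 2)) // real_normK ?num_real.
have nc : continuous (@normq2 R).
  have m n : continuous (fun x : H => qc x n ^+ 2).
    by apply: ctsM; exact: qc_continuous.
  exact: (ctsD (ctsD (ctsD (m 0) (m 1)) (m 2)) (m 3)).
rewrite [sphere3 R](_ : _ = normq2 @^-1` [set x | x = 1]) //.
by apply: preimage_closed; [move=> x _; exact: nc|exact: closed_eq].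
Qed.

Lemma base_radius_compact (M : R) : compact [set z : base R a | val z.1.1 <= M].
Proof.
have S3c : compact [set: S3 R].
  apply: set_type_compact; rewrite (_ : _ @` _ = sphere3 R); first exact: sphere3_compact.
  by apply/seteqP; split=> [_ [[x xP] _ <-]|x xP];
    [exact: set_mem|exists (exist _ x (mem_set xP))].
have rc : compact [set r : set_type (@radii R a) | val r <= M].
  apply: set_type_compact.
  rewrite (_ : _ @` _ = `[0, M]%classic `&` ((fun r => r ^+ 3) @^-1` [set x | 4 * a <= x])).
    apply: compact_closedI; first exact: segment_compact.
    apply: preimage_closed; last exact: closed_ge.
    by move=> r _; exact: exprn_continuous.
  apply/seteqP; split=> [_ [[r rP] /= rM <-]|r [/= rM rP]].
    have := set_mem rP; rewrite /radii /= => rP'; split=> //.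
    rewrite /= in_itv /= rM andbT leNgt; apply/negP => r0.
    have := lt_le_trans (mulr_gt0 (ltr0n R 4) a0) rP'.
    by rewrite exprS ltNge mulr_le0_ge0 ?sqr_ge0 // ltW.
  exists (exist _ r (mem_set rP)) => //=.
  by move: rM; rewrite in_itv /= => /andP[].
have := compact_setX (compact_setX rc S3c) S3c.
congr compact; apply/seteqP; split => [[[r p] q] [[]]//|[[r p] q] rM].
by split=> //; split.
Qed.

(** As |z| <= 1, the relation [gram x y z w = 0] gives 1 <= 2 x^2 + 2 y^2 + z^2 + w^2.  For
    r >= 1 each of x, y, z, w is at most N / (2/27 (r^3 - 4a)) in absolute value. *)
Lemma radius_bounded (N : R) : exists M, forall z : base R a,
  `|base_numu z| <= N -> val z.1.1 <= M.
Proof.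
exists (1 + 3 * N / (2 / 27) + 4 * a) => z zN.
have N0 : 0 <= N by exact: le_trans zN.
have t0 : 0 <= 3 * N / (2 / 27) by rewrite !mulr_ge0 // invr_ge0 divr_ge0.
have a4 : 0 <= 4 * a by rewrite mulr_ge0 // ltW.
have [r1|r1] := leP (val z.1.1) 1.
  by rewrite -addrA (le_trans r1) // lerDl addr_ge0.
have coord n : (n < 4)%N -> `|qc (base_numu z) n| <= N.
  move=> n4; apply: le_trans zN; rewrite [leRHS]mx_normrE.
  exact: (le_bigmax _ (fun ij => `|base_numu z ij.1 ij.2|) (0, inord n)).
have := gram_base z; cbv zeta.
have := dotIm_le1 (hopf_re (val z.1.2)) (hopf_re (val z.2)) (normq2_hopfS3 _) (normq2_hopfS3 _).
have := coord 0 isT; have := coord 1 isT; have := coord 2 isT; have := coord 3 isT.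
rewrite base_numuE !qc_point4.
move: (dotIm (hopf (val z.1.2)) qi) (dotIm (hopf (val z.2)) qi)
  (dotIm (hopf (val z.1.2)) (hopf (val z.2))) (tripleIm _ _) => x y d w.
have s0 : 0 <= val z.1.1 ^+ 3 - 4 * a by rewrite subr_ge0 radius_ge.
have r3 : val z.1.1 <= val z.1.1 ^+ 3 by rewrite ler_eXnr // ltW.
move: (val z.1.1) r1 s0 r3 => r r1 s0 r3.
pose s := r ^+ 3 - 4 * a.
have kc : 2 / 27 <= @nu_scale R.
  rewrite -(ler_pXn2r (n := 2)) ?nnegrE //; last exact/ltW/nu_scale_gt0.
  by rewrite nu_scale_sqr ler_peMl ?sqr_ge0 // ler1n.
have small (k u : R) : 2 / 27 * s <= k -> `|k * u| <= N -> (2 / 27 * s) ^+ 2 * u ^+ 2 <= N ^+ 2.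
  move=> sk ku; rewrite -exprMn -real_normK ?num_real // ler_pXn2r ?nnegrE //.
  apply: le_trans ku; rewrite !normrM ler_wpM2r //.
  have s0' : 0 <= 2 / 27 * s by rewrite mulr_ge0 ?divr_ge0.
  rewrite -normrM !ger0_norm //; exact: le_trans sk.
move=> W D Y X d1 g.
have k0 : 0 <= 2 / 27 :> R by rewrite divr_ge0.
have sc : 2 / 27 * s <= @nu_scale R * s by rewrite ler_wpM2r.
have hx := small _ _ sc X; have hy := small _ _ sc Y.
have hd : (2 / 27 * s) ^+ 2 * d ^+ 2 <= N ^+ 2.
  apply: small D; rewrite (le_trans sc) // ler_pM2l ?nu_scale_gt0 // /s lerD2l lerN2.
  by move: a0; lra.
have hw : (2 / 27 * s) ^+ 2 * w ^+ 2 <= N ^+ 2.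
  by apply: small W; rewrite -(mulrA (2 / 27)) ler_wpM2l // ler_peMl // ltW.
have bound : 1 <= 2 * x ^+ 2 + 2 * y ^+ 2 + d ^+ 2 + w ^+ 2.
  have e : 2 * x ^+ 2 + 2 * y ^+ 2 + d ^+ 2 + w ^+ 2 - 1 =
      ((1 + d) * (x + y) ^+ 2 + (1 - d) * (x - y) ^+ 2) / 2 - gram x y d w.
    by rewrite /gram; field.
  rewrite -subr_ge0 e g subr0.
  move: d1; rewrite ler_norml => /andP[dN d1].
  rewrite divr_ge0 // addr_ge0 // mulr_ge0 ?sqr_ge0 ?subr_ge0 //.
  by rewrite -[1]opprK addrC subr_ge0.
have q : (2 / 27 * s) ^+ 2 <= (3 * N) ^+ 2.
  rewrite [(3 * N) ^+ 2](_ : _ = 9 * N ^+ 2); last by ring.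
  have := ler_wpM2l (sqr_ge0 (2 / 27 * s)) bound; have := sqr_ge0 N.
  move: ((2 / 27 * s) ^+ 2) hx hy hd hw => K; move: (N ^+ 2) => N2.
  by rewrite mulr1 !mulrDr !(mulrCA K); lra.
have s0' : 0 <= 2 / 27 * s by rewrite mulr_ge0.
have {q} q : 2 / 27 * s <= 3 * N by rewrite -(ler_pXn2r (n := 2)) // nnegrE mulr_ge0.
have : s <= 3 * N / (2 / 27) by rewrite ler_pdivlMr ?divr_gt0 // mulrC.
by move: (3 * N / _) => m; rewrite /s; move: r3; lra.
Qed.

Definition orbit_numu (o : orbit_space a) : H := spin_numu (repr o).

Lemma orbit_numuE x : orbit_numu (\pi_(orbit_space a) x) = spin_numu x.
Proof.
apply: (@spin_numu_orbit R a).
by apply/(@eqquotP _ _ {eq_quot (same_orbit_equiv a)}); rewrite reprK.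
Qed.

(** Any section s of the map on the total space induces the inverse; the preimage of a
    closed set under the inverse is a direct image, closed by [proper_closed_image]. *)
Lemma orbit_numu_homeomorphism : homeomorphism orbit_numu.
Proof.
split.
  apply/quotient_continuous.
  rewrite (_ : _ \o _ = @spin_numu R a); first exact: spin_numu_continuous.
  by apply/funext => x; exact: orbit_numuE.
have [s sE] := choice (base_numu_surjective a0).
pose pr (z : base R a) : orbit_space a := \pi_(orbit_space a) (\pi_(spin_bundle a) z).
have prc : continuous pr.
  move=> z; apply: (@continuous_comp _ _ _ (\pi_(spin_bundle a)) (\pi_(orbit_space a))).
    exact: pi_continuous.
  exact: pi_continuous.
have prE z : orbit_numu (pr z) = base_numu z by rewrite orbit_numuE spin_numuE.
have inj z w : base_numu z = base_numu w -> pr z = pr w.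
  move=> zw; apply/(@eqquotP _ _ {eq_quot (same_orbit_equiv a)}).
  exact: numu_inj.
exists (fun v => pr (s v)); split.
- apply/continuous_closedP => C cC.
  rewrite (_ : _ @^-1` _ = @base_numu R a @` (pr @^-1` C)).
    apply: proper_closed_image.
    + exact: base_numu_continuous.
    + move=> N; have [M MP] := radius_bounded N.
      by exists [set z | val z.1.1 <= M]; [exact: base_radius_compact|exact: MP].
    + by apply: preimage_closed => // z _; exact: prc.
  apply/seteqP; split=> [v /= Cv|_ [z Cz <-] /=]; first by exists (s v).
  by rewrite (inj _ z).
- move=> b; rewrite -[b]reprK -[repr b]reprK -/(pr _).
  by apply: inj; rewrite sE prE.
- by move=> v; rewrite prE sE.
Qed.

End Homeo.

(** * The image of the singular orbits *)

Section Singular.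
Context {R : realType} (a : R).
Local Notation H := 'rV[R]_4.
Local Notation c := (@nu_scale R).
Hypothesis a0 : 0 < a.
Implicit Types (z : base R a) (A : H) (e k t : R).

Lemma normq2Z k A : normq2 (k *: A) = k ^+ 2 * normq2 A.
Proof. by rewrite /normq2 !qcZ; ring. Qed.

Lemma normq2_qi : normq2 (qi : H) = 1.
Proof. by rewrite /normq2 !qcE; ring. Qed.

Lemma sign_sqr e : e ^+ 2 = 1 <-> e = 1 \/ e = -1.
Proof.
split=> [/eqP|].
  by rewrite sqrf_eq1 => /orP[/eqP|/eqP]; [left|right].
by case=> ->; rewrite ?sqrrN expr1n.
Qed.

Lemma unit_axis A e : qc A 0 = 0 -> normq2 A = 1 -> e ^+ 2 = 1 -> dotIm A qi = e ->
  A = e *: qi.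
Proof.
move=> A0; rewrite /normq2 /dotIm A0 !qcE => A1 e1 Ae.
have Ae' : qc A 1 = e by rewrite -Ae; ring.
have : qc A 2 ^+ 2 + qc A 3 ^+ 2 == 0.
  by apply/eqP; move: A1; rewrite Ae' e1; lra.
rewrite paddr_eq0 ?sqr_ge0 // !sqrf_eq0 => /andP[/eqP A2 /eqP A3].
by apply: quat_ext; rewrite qcZ !qcE ?A0 ?Ae' ?A2 ?A3; ring.
Qed.

(** Dividing the two quaternionic components by p and q on the left turns U_1, U_2 and
    U_3 into (A, 0), (0, B) and (-i, -i). *)
Lemma U_dependence z k0 k1 k2 :
  k0 *: U_field 0 z + (k1 *: U_field 1 z + k2 *: U_field 2 z) = 0 <->
  k0 *: hopf (val z.1.2) = k2 *: qi /\ k1 *: hopf (val z.2) = k2 *: qi.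
Proof.
have comp k (p : S3 R) : k *: mulq qi (val p) + k2 *: - mulq (val p) qi = 0 <->
    k *: hopf (val p) = k2 *: qi.
  have -> : k *: mulq qi (val p) + k2 *: - mulq (val p) qi =
      mulq (val p) (k *: hopf (val p) - k2 *: qi).
    by rewrite mulqDr mulqN !mulqZr -mulqi_hopf ?S3P // scalerN.
  split=> [/(@mulqI R)|->]; last by rewrite subrr mulq0.
  by rewrite S3P oner_neq0 => /(_ isT) /subr0_eq.
rewrite -(comp k0 z.1.2) -(comp k1 z.2).
split=> [e|[e1 e2]].
  have := congr1 (fun y => y.1.2) e; have := congr1 snd e.
  by rewrite /= !scaler0 !add0r.
by congr (_, _, _); rewrite /= ?scaler0 ?add0r ?e1 ?e2 // /GRing.scale /= !mulr0 !addr0.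
Qed.

(** In a dependence k0 A = k2 i, k1 B = k2 i the coefficient k2 cannot vanish, so A and B
    are unit multiples of i; conversely (e2, e1, 1) is a dependence. *)
Lemma singular_off_zero z : off_zero z ->
  singular_point (\pi_(spin_bundle a) z) <->
  exists e1 e2, [/\ e1 ^+ 2 = 1, e2 ^+ 2 = 1,
    hopf (val z.1.2) = e2 *: qi & hopf (val z.2) = e1 *: qi].
Proof.
move=> /singular_point_off_zero ->; split=> [[k [kN]]|[e1 [e2 [s1 s2 pE qE]]]].
  rewrite (sum3 k (fun j => U_field j z)) U_dependence => -[].
    have axis x y (p : S3 R) : y != 0 -> x *: hopf (val p) = y *: qi ->
      (y / x) ^+ 2 = 1 /\ hopf (val p) = (y / x) *: qi.
    move=> y0 e; have x0 : x != 0.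
      apply: contra_neq y0 => x0; apply/eqP; rewrite -sqrf_eq0.
      by rewrite -[_ ^+ 2]mulr1 -normq2_qi -normq2Z -e x0 scale0r -(scale0r qi) normq2Z expr0n mul0r.
    have pE : hopf (val p) = (y / x) *: qi.
      by rewrite mulrC -scalerA -e scalerA mulVf // scale1r.
    by split=> //; rewrite -(normq2_hopfS3 p) pE normq2Z normq2_qi mulr1.
  have [k20|k20] := eqVneq (k 0 (lift ord0 (lift ord0 ord0))) 0.
    have zero x (p : S3 R) : x *: hopf (val p) = 0 -> x = 0.
      move=> e; apply/eqP; rewrite -sqrf_eq0 -[_ ^+ 2]mulr1 -(normq2_hopfS3 p) -normq2Z e.
      by rewrite -(scale0r qi) normq2Z expr0n mul0r.
    rewrite k20 scale0r => /zero k00 /zero k10; case/eqP: kN; apply/rowP => j.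
    rewrite mxE; case: (unliftP ord0 j) => [i ->|->] //.
    case: (unliftP ord0 i) => [l ->|->] //.
    by rewrite (ord1 l).
  move=> /(axis _ _ _ k20)[s2 pE] /(axis _ _ _ k20)[s1 qE].
  by exists (k 0 (lift ord0 (lift ord0 ord0)) / k 0 (lift ord0 ord0)),
    (k 0 (lift ord0 (lift ord0 ord0)) / k 0 ord0).
exists (\row_j [:: e2; e1; 1]`_j); split.
  by apply/eqP => /rowP /(_ (lift ord0 (lift ord0 ord0))); rewrite !mxE => /eqP; rewrite oner_eq0.
rewrite (sum3 _ (fun j => U_field j z)) !mxE /= U_dependence pE qE !scalerA.
by rewrite -!expr2 s1 s2.
Qed.

Definition singular_set k : set H :=
  [set point4 0 0 s 0 | s in [set` `[- k, k]]] `|`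
  [set y | exists e1 e2 t : R, [/\ e1 = 1 \/ e1 = -1, e2 = 1 \/ e2 = -1, 0 <= t
    & y = point4 (e1 * t) (e2 * t) (e1 * e2 * (t + k)) 0]].

Lemma nu_scale_zero_section : c * (3 * a) = 2 * a / (3 * Num.sqrt 3).
Proof.
have s3 : Num.sqrt 3 != 0 :> R by rewrite sqrtr_eq0 -ltNge.
by rewrite /nu_scale; field.
Qed.

(** For the converse, each point of the segment is also the image of a point of the zero
    section, and each point of a half-line that of a point with A and B among i and -i.
    By [radius_unique] z has the same radius, so it lies on the zero section as well, or
    nu_1 and nu_2 determine the components of A and B along i. *)
Lemma singular_pointP z : singular_point (\pi_(spin_bundle a) z) <->
  singular_set (c * (3 * a)) (base_numu z).
Proof.
set k := c * (3 * a).
have c0 := @nu_scale_gt0 R.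
have k0 : 0 < k by rewrite !mulr_gt0.
have TE r : c * (r ^+ 3 - a) = c * (r ^+ 3 - 4 * a) + k by rewrite /k; ring.
have ge := radius_ge z.
split.
  have [z0|z0] := eqVneq (4 * a) (val z.1.1 ^+ 3).
    move=> _; left; exists (k * dotIm (hopf (val z.1.2)) (hopf (val z.2))).
      have : `|dotIm (hopf (val z.1.2)) (hopf (val z.2))| <= 1.
        exact: (dotIm_le1 (hopf_re _) (hopf_re _) (normq2_hopfS3 _) (normq2_hopfS3 _)).
      move=> d1; rewrite /= in_itv /= -ler_norml (normrM k) (gtr0_norm k0).
      by rewrite ler_piMr // ltW.
    by rewrite base_numuE TE -z0 subrr !(mulr0, mul0r, add0r).
  have off : off_zero z by rewrite /off_zero lt_neqAle z0.
  move=> /(singular_off_zero off)[e1 [e2 [s1 s2 pE qE]]]; right.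
  exists e1, e2, (c * (val z.1.1 ^+ 3 - 4 * a)).
  split; [exact/sign_sqr|exact/sign_sqr|by rewrite mulr_ge0 ?subr_ge0 // ltW|].
  rewrite base_numuE pE qE TE /tripleIm /dotIm !qcZ !qcE; congr point4; ring.
move=> h; have [z0|z0] := eqVneq (4 * a) (val z.1.1 ^+ 3).
  exact: singular_point_zero.
have off : off_zero z by rewrite /off_zero lt_neqAle z0.
case: h => [[t /= tk tE]|[e1 [e2 [t [s1 s2 t0 tE]]]]].
  have [r _ rE] := @cube_root R (4 * a) ltac:(by rewrite mulr_ge0 // ltW).
  have tk1 : `|t / k| <= 1.
    by rewrite normrM normfV (gtr0_norm k0) ler_pdivrMr // mul1r ler_norml; rewrite in_itv in tk.
  have g : gram 0 0 (t / k) (Num.sqrt (1 - (t / k) ^+ 2)) = 0.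
    rewrite /gram sqr_sqrtr; first by ring.
    by rewrite subr_ge0 -real_normK ?num_real // expr_le1.
  have zero1 : `|0 : R| <= 1 by rewrite normr0.
  have r4 : 4 * a <= r ^+ 3 by rewrite rE.
  have [b [br bE]] := base_numu_gram r4 g zero1 zero1.
  case/eqP: z0; rewrite -rE -br; congr (_ ^+ 3); apply: (radius_unique a0).
  rewrite -tE bE TE rE subrr !(mulr0, mul0r, add0r).
  by congr point4; rewrite mulrCA divff ?mulr1 // gt_eqF.
move: s1 s2 => /sign_sqr s1 /sign_sqr s2.
have [|r _ rE] := @cube_root R (t / c + 4 * a).
  by rewrite addr_ge0 // ?divr_ge0 ?mulr_ge0 // ltW.
have ct : c * (r ^+ 3 - 4 * a) = t.
  by rewrite rE addrK mulrCA divff ?mulr1 // gt_eqF.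
have g : gram e2 e1 (e1 * e2) 0 = 0.
  rewrite /gram [LHS](_ : _ = (1 - e1 ^+ 2) * (1 - e2 ^+ 2)); last by ring.
  by rewrite s1 subrr mul0r.
have n1 e : e ^+ 2 = 1 -> `|e| <= 1.
  by move=> e1'; rewrite -(expr_le1 (n := 2)) // real_normK ?num_real // e1'.
have r4 : 4 * a <= r ^+ 3 by rewrite rE lerDr divr_ge0 // ltW.
have [b [br bE]] := base_numu_gram r4 g (n1 _ s2) (n1 _ s1).
have rr : val z.1.1 = r.
  rewrite -br; apply: (radius_unique a0); rewrite tE bE TE ct.
  by congr point4; ring.
apply/(singular_off_zero off); exists e1, e2.
have tN : t != 0 by rewrite -ct -rr mulf_neq0 ?gt_eqF // subr_gt0.
move: tE; rewrite base_numuE rr ct => /point4_inj[yE xE _ _].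
split=> //; apply: unit_axis; rewrite ?hopf_re ?normq2_hopfS3 //; apply: (mulfI tN).
  by rewrite xE mulrC.
by rewrite yE mulrC.
Qed.

End Singular.

(** * The trivalent graph *)

Section Skeleton.
Context {R : realType} (k : R).
Local Notation H := 'rV[R]_4.
Local Notation G := (skeleton k).
Hypothesis k0 : 0 < k.

Lemma sign_or (b : bool) : (-1) ^+ b = 1 :> R \/ (-1) ^+ b = -1 :> R.
Proof. by case: b; [right|left]; rewrite ?expr1. Qed.

Lemma sign_inj (b b' : bool) (s t : R) : 0 < s -> 0 < t ->
  (-1) ^+ b * s = (-1) ^+ b' * t -> b = b' /\ s = t.
Proof.
by case: b b' => -[] /=; rewrite ?expr1 ?expr0 ?mulN1r ?mul1r => s0 t0 e; split=> //; lra.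
Qed.

Lemma skeleton_segment (t : R) : 0 <= t <= 1 -> - k <= (2 * t - 1) * k <= k.
Proof.
have k0' := ltW k0.
move=> /andP[t0 t1]; apply/andP; split; rewrite -subr_ge0.
  have -> : (2 * t - 1) * k - - k = 2 * t * k by ring.
  by rewrite !mulr_ge0.
have -> : k - (2 * t - 1) * k = 2 * (1 - t) * k by ring.
by rewrite !mulr_ge0 // subr_ge0.
Qed.

Lemma skeleton_carrier : carrier G = singular_set k.
Proof.
apply/seteqP; split=> y.
  case=> [|[[[b1 b2]|] _ [t]]].
  - rewrite /= !inE => /orP[/eqP ->|/eqP ->]; left.
      by exists (- k) => //; rewrite /= in_itv /= lexx ge0_cp // ltW.
    by exists k => //; rewrite /= in_itv /= lexx andbT ge0_cp // ltW.
  - rewrite /edge_dom /= in_itv /= andbT => t0 <-; right.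
    by exists ((-1) ^+ b1), ((-1) ^+ b2), t; split=> //; exact: sign_or.
  - rewrite /edge_dom /= in_itv /= => t01 <-; left.
    by exists ((2 * t - 1) * k) => //; rewrite /= in_itv /= skeleton_segment.
have sign (e : R) : e = 1 \/ e = -1 -> exists b : bool, e = (-1) ^+ b.
  by case=> ->; [exists false|exists true].
case=> [[s /= sk <-]|[e1 [e2 [t [/sign[b1 ->] /sign[b2 ->] t0 ->]]]]]; right.
  exists None => //; exists ((s / k + 1) / 2).
    move: sk; rewrite in_itv /= => /andP[s1 s2].
    have q1 : s / k <= 1 by rewrite ler_pdivrMr // mul1r.
    have q0 : -1 <= s / k by rewrite ler_pdivlMr // mulN1r.
    by rewrite /edge_dom /= in_itv /=; apply/andP; split; lra.
  rewrite /=; congr point4; field; exact: lt0r_neq0.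
by exists (Some (b1, b2)) => //; exists t => //; rewrite /edge_dom /= in_itv /= t0.
Qed.

Lemma skeleton_continuous (e : edge G) : continuous (edge_path e).
Proof.
have idc : continuous (fun t : R => t) by move=> t; exact: cvg_id.
have cc (u : R) : continuous (fun _ : R => u) by move=> t; exact: cvg_cst.
case: e => [[b1 b2]|]; apply: cts_quat.
- exact: (ctsM (cc _) idc).
- exact: (ctsM (cc _) idc).
- exact: (ctsM (cc _) (ctsD idc (cc _))).
- exact: cc.
- exact: cc.
- exact: cc.
- exact: (ctsM (ctsB (ctsM (cc _) idc) (cc _)) (cc _)).
- exact: cc.
Qed.

(** The half-lines issued from the lower vertex are those with opposite signs. *)
Lemma skeleton_start (e : edge G) : edge_path e 0 =
  point4 0 0 (if (if e is Some (b1, b2) then b1 (+) b2 else true) then - k else k) 0.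
Proof.
case: e => [[b1 b2]|] /=; congr point4; rewrite ?mulr0 //; last by ring.
by rewrite -signr_addb add0r; case: (_ (+) _); rewrite ?mulN1r ?mul1r.
Qed.

Lemma skeleton_end : edge_path (None : edge G) 1 = point4 0 0 k 0.
Proof. by rewrite /=; congr point4; ring. Qed.

Lemma vertex_neq : (point4 0 0 (- k) 0 == point4 0 0 k 0 :> H) = false.
Proof. by apply/eqP => /point4_inj[_ _ e _]; move: k0; lra. Qed.

Lemma skeleton_is_graph : is_graph G.
Proof.
split.
- by rewrite /= inE vertex_neq.
- move=> e; exact/continuous_subspaceT/skeleton_continuous.
- by move=> e; rewrite skeleton_start !inE; case: ifP; rewrite eqxx ?orbT.
- by case=> [//|] _; rewrite skeleton_end !inE eqxx orbT.
- move=> [[b1 b2]|//] _ K cK; have [M [_ KM]] := compact_bounded cK.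
  exists (Num.max (M + 1) 0); split; first exact: num_real.
  move=> t; rewrite gt_max => /andP[Mt t0] Kt.
  have M1 : M < M + 1 by rewrite ltrDl.
  have := KM _ M1 _ Kt; rewrite /= leNgt => /negP; apply; apply: (lt_le_trans Mt).
  rewrite [leLHS](_ : _ = `|qc (edge_path (Some (b1, b2) : edge G) t) 0|); last first.
    by rewrite qc_point4 normrM normrX normrN1 expr1n mul1r gtr0_norm.
  rewrite [leRHS]mx_normrE.
  exact: (le_bigmax _ (fun ij => `|edge_path (Some (b1, b2) : edge G) t ij.1 ij.2|)
    (0, inord 0)).
- move=> [[b1 b2]|] t; rewrite /edge_interior /= in_itv /= ?andbT => t0.
    by rewrite !inE; apply/norP; split; apply/eqP => /point4_inj[/eqP + _ _ _];
      rewrite mulf_eq0 signr_eq0 (gt_eqF t0).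
  case/andP: t0 => t0 t1; rewrite !inE; apply/norP.
  split; apply/eqP => /point4_inj[_ _ /eqP + _].
    rewrite -subr_eq0 (_ : _ - _ = 2 * t * k); last by ring.
    by rewrite !mulf_eq0 (gt_eqF t0) (gt_eqF k0) pnatr_eq0.
  rewrite -subr_eq0 (_ : _ - _ = 2 * (t - 1) * k); last by ring.
  by rewrite !mulf_eq0 subr_eq0 (lt_eqF t1) (gt_eqF k0) pnatr_eq0.
- move=> [[b1 b2]|] [[c1 c2]|] s t; rewrite /edge_interior /= !in_itv /= ?andbT => s0 t0.
  + move=> /point4_inj[e1 e2 _ _].
    have [-> ->] := sign_inj s0 t0 e1; by have [-> _] := sign_inj s0 t0 e2.
  + move=> /point4_inj[/eqP]; by rewrite mulf_eq0 signr_eq0 (gt_eqF s0).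
  + move=> /point4_inj[/esym/eqP]; by rewrite mulf_eq0 signr_eq0 (gt_eqF t0).
  + move=> /point4_inj[_ _ /(mulIf (lt0r_neq0 k0)) e _]; split=> //; lra.
Qed.

Lemma skeleton_trivalent : trivalent G.
Proof.
have card (P : pred (edge G)) (s : seq (edge G)) : P =i s -> uniq s -> #|P| = size s.
  by move=> /eq_card -> /card_uniqP.
move=> v; rewrite !inE /degree => /orP[/eqP ->|/eqP ->].
  rewrite (card _ [:: None; Some (true, false); Some (false, true)]) //; last first.
    move=> e; rewrite inE skeleton_start.
    by case: e => [[[] []]|] /=; rewrite ?eqxx // eq_sym vertex_neq.
  rewrite (card _ [::]) // => e; rewrite inE.
  by case: e => [//|]; rewrite skeleton_end eq_sym vertex_neq andbF.
rewrite (card _ [:: Some (true, true); Some (false, false)]) //; last first.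
  move=> e; rewrite inE skeleton_start.
  by case: e => [[[] []]|] /=; rewrite ?eqxx // vertex_neq.
rewrite (card _ [:: None]) // => e; rewrite inE.
by case: e => [//|]; rewrite skeleton_end eqxx.
Qed.

(** Each edge together with the segment is connected, since edges start at vertices and
    the segment contains both vertices. *)
Lemma skeleton_connected : connected (carrier G).
Proof.
have conn (e : edge G) : connected (edge_path e @` edge_dom e).
  apply: connected_continuous_connected.
    by rewrite /edge_dom; case: ifP => _; apply/connected_intervalP/interval_is_interval.
  exact/continuous_subspaceT/skeleton_continuous.
pose S := edge_path (None : edge G) @` edge_dom (None : edge G).
have start (e : edge G) : (edge_path e @` edge_dom e) (edge_path e 0).
  by exists 0 => //; rewrite /edge_dom; case: ifP => _; rewrite /= in_itv /= ?lexx ?ler01.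
have vertexS (v : H) : v \in vertices G -> S v.
  rewrite !inE => /orP[/eqP ->|/eqP ->]; first by have := start None; rewrite skeleton_start.
  exists 1; last exact: skeleton_end.
  by rewrite /edge_dom /= in_itv /= ler01 lexx.
rewrite (_ : carrier G = \bigcup_(e : edge G) (S `|` edge_path e @` edge_dom e)).
  apply: bigcup_connected.
    by exists (point4 0 0 k 0) => e _; left; apply: vertexS; rewrite !inE eqxx orbT.
  move=> e _; apply: connectedU; [|exact: conn|exact: conn].
  exists (edge_path e 0); split; last exact: start.
  by apply: vertexS; exact: graph_start skeleton_is_graph e.
apply/seteqP; split=> y.
  case=> [/vertexS Sy|[e _ ey]]; first by exists None => //; left.
  by exists e => //; right.
by case=> e _ [Sy|ey]; right; [exists None|exists e].
Qed.

End Skeleton.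

(** * The orbit space and its singular graph *)

Unset Implicit Arguments.

Theorem mainTheorem7 (R : realType) (a : R) (ha : 0 < a) :
  let k := 2 * a / (3 * Num.sqrt 3) in
  let segment := [set point4 0 0 s 0 | s in [set` `[- k, k]]] in
  let half_lines := [set y | exists e1 e2 t : R,
    [/\ e1 = 1 \/ e1 = -1, e2 = 1 \/ e2 = -1, 0 <= t
      & y = point4 (e1 * t) (e2 * t) (e1 * e2 * (t + k)) 0]] in
  exists h : orbit_space a -> 'rV[R]_4,
    [/\ homeomorphism h,
        forall x : spin_bundle a, h (\pi_(orbit_space a) x) = numu a x,
        h @` singular_orbits = segment `|` half_lines,
        carrier (skeleton k) = segment `|` half_lines
      & [/\ is_graph (skeleton k), trivalent (skeleton k)
          & connected (carrier (skeleton k))]].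
Proof.
move=> k segment half_lines.
have kE : k = nu_scale * (3 * a) by rewrite nu_scale_zero_section.
have k0 : 0 < k by rewrite kE !mulr_gt0 // nu_scale_gt0.
have singular_setE : segment `|` half_lines = singular_set k by [].
have carrierE : carrier (skeleton k) = singular_set k by exact: skeleton_carrier.
exists (@orbit_numu R a); split.
- exact: orbit_numu_homeomorphism.
- exact: orbit_numuE.
- rewrite singular_setE kE; apply/seteqP; split=> [_ [b bs <-]|v vs].
    have := bs (repr b) (reprK b).
    rewrite /orbit_numu -[repr b]reprK spin_numuE.
    by move=> /(singular_pointP ha).
  have [z zv] := base_numu_surjective ha v.
  exists (\pi_(orbit_space a) (\pi_(spin_bundle a) z)); last by rewrite orbit_numuE spin_numuE.
  move=> x /(congr1 (@orbit_numu R a)); rewrite !orbit_numuE -[x]reprK !spin_numuE zv => xv.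
  by apply/(singular_pointP ha); rewrite xv.
- by rewrite carrierE.
- split.
  + exact: skeleton_is_graph.
  + exact: skeleton_trivalent.
  + exact: skeleton_connected.
Qed.
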